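(* Let $n>1$ and $d\geq 3$ be integers with $\gcd(n,d)=1$, and let $a,b$ be indeterminates. Then \[ \sum_{k=0}^{n-1}[2dk-1]\frac{(aq^{-1},q^{-1}/a,bq^{-1},q^{-1}/b;q^d)_k(q^{-1};q^d)_k^2}{(aq^d,q^d/a,bq^d,q^d/b;q^d)_k(q^d;q^d)_k^2}q^{(2d+3)k} \equiv\begin{cases}0 \pmod{[n]\Phi_n(q)}, &\text{if }n\equiv 1\pmod{d},\\[5pt] 0 \pmod{[n]},&\text{otherwise}. \end{cases} \]
   Context: For an integer $m$, $[m]=[m]_q=(1-q^m)/(1-q)$ denotes the $q$-integer (so $[-1]=-q^{-1}$). The $q$-shifted factorial is $(x;q)_0=1$ and $(x;q)_k=(1-x)(1-xq)\cdots(1-xq^{k-1})$ for $k\geq1$, with $(x_1,\dots,x_m;q)_k=(x_1;q)_k\cdots(x_m;q)_k$. $\Phi_n(q)$ is the $n$-th cyclotomic polynomial in $q$. For rational functions $A,B$ in $q$ (with coefficients involving the indeterminates $a,b$) and a polynomial $P(q)$, $A\equiv B\pmod{P(q)}$ means that the numerator of $A-B$ (in reduced form) is divisible by $P(q)$ and its denominator is coprime to $P(q)$. *)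

(* Defs.v *)
From HB Require Import structures.
From mathcomp Require Import all_boot all_order all_algebra all_field.

Set Implicit Arguments.
Unset Strict Implicit.
Unset Printing Implicit Defensive.

Import GRing.Theory.
Local Open Scope ring_scope.

Definition qint (F : fieldType) (q : F) (m : int) : F := (1 - q ^ m) / (1 - q).

Definition qpoch (F : fieldType) (x q : F) (k : nat) : F :=
  \prod_(i < k) (1 - x * q ^+ i).

Definition qpochs (F : fieldType) (xs : seq F) (q : F) (k : nat) : F :=
  \prod_(x <- xs) qpoch x q k.

(* [A = B mod P] for rational functions over [K] in one variable; [N / D] is
   the reduced form of [A - B], which is unique up to a nonzero constant. *)
Definition ratcong (K : fieldType) (P : {poly K}) (A B : {fraction {poly K}}) :
    Prop :=
  exists N D : {poly K},
    [/\ D != 0, coprimep N D, A - B = tofrac N / tofrac D,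
        P %| N & coprimep D P].

(* The modulus [n] as a polynomial; the division is exact, see [tofrac_qintp]. *)
Definition qintp (K : fieldType) (n : nat) : {poly K} := (1 - 'X^n) %/ (1 - 'X).

Definition cyclop (K : fieldType) (n : nat) : {poly K} :=
  map_poly (fun c : int => c%:~R) ('Phi_n).

Lemma tofrac_qintp (K : fieldType) (n : nat) :
  tofrac (qintp K n) = qint (tofrac 'X) n%:Z.
Proof.
have X1 : 1 - 'X != 0 :> {poly K}.
  by rewrite -oppr_eq0 opprB -[1]/(1%:P) polyXsubC_eq0.
have E : (1 - 'X^n : {poly K}) = qintp K n * (1 - 'X).
  rewrite /qintp divpK // -dvdpNr -dvdpNl !opprB subrX1.
  exact: dvdp_mulr.
rewrite /qint -exprnP -tofracXn -tofrac1 -!tofracB E tofracM mulfK //.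
by rewrite tofrac_eq0.
Qed.

(* Q(a, b), as the fraction field of Q[a][b]. *)
Definition Qab : fieldType := {fraction {poly {poly rat}}}.

Definition indet_a : Qab := tofrac 'X%:P.
Definition indet_b : Qab := tofrac 'X.

(* Q(a, b)(q). *)
Definition Qabq : fieldType := {fraction {poly Qab}}.

Definition var_q : Qabq := tofrac 'X.
Definition var_a : Qabq := tofrac indet_a%:P.
Definition var_b : Qabq := tofrac indet_b%:P.

(* Main.v *)
Require Import Defs.
From mathcomp Require Import all_boot all_order all_algebra all_field.
From mathcomp Require Import ring zify.

(** Up to the factor 1/(1 - q), the sum is a very-well-poised sum in base
p = q^d with A = 1/q, numerator parameters a/q, 1/(aq), b/q, 1/(bq), 1/q, 1/q
and argument q^(2d+3).  We work modulo each cyclotomic polynomial Phi_m with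
m | n, m > 1, in the ring of fractions whose denominator is coprime to Phi_m.

Let dM = 1 mod m with M < m.  When A = p^-M, the terms k and M - k of a
very-well-poised sum cancel, and 1/q = p^-M mod Phi_m; the terms M < k < m
vanish mod Phi_m^2.  So each block of m consecutive terms vanishes mod Phi_m,
the blocks after the first being congruent to integral multiples of it.

If n = ds + 1 and m = n, deform the two occurrences of 1/q, namely A and one
free parameter f, independently to p^-M.  The mixed difference of the sum W(A, f)
is 0 mod Phi_n^2 and W(p^-M, f) = 0, so W(1/q, 1/q) = W(1/q, p^-M) mod Phi_n^2.
Watson's transformation writes the latter as (A;p)_(M+1) times a sum whose j-th
term contains (pq;p)_j (pq;p)_(M-j); here Phi_n divides the prefactor and every
term. *)

Import GRing.Theory.
Local Open Scope ring_scope.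
Set Implicit Arguments.
Unset Strict Implicit.

(** * Terminating basic hypergeometric sums *)

Section QPoch.
Context {F : fieldType}.
Implicit Types (x p : F) (k : nat).

Lemma qpoch0 x p : qpoch x p 0 = 1.
Proof. by rewrite /qpoch big_ord0. Qed.

Lemma qpochS x p k : qpoch x p k.+1 = qpoch x p k * (1 - x * p ^+ k).
Proof. by rewrite /qpoch big_ord_recr. Qed.

Lemma qpochD x p k l : qpoch x p (k + l) = qpoch x p k * qpoch (x * p ^+ k) p l.
Proof.
elim: l => [|l IH]; first by rewrite addn0 qpoch0 mulr1.
by rewrite addnS !qpochS IH exprD !mulrA.
Qed.

Lemma qpochSl x p k : qpoch x p k.+1 = (1 - x) * qpoch (x * p) p k.
Proof. by rewrite -add1n qpochD expr1 qpochS qpoch0 expr0 mulr1 mul1r. Qed.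

Lemma qpoch_neq0 x p k : (forall i, (i < k)%N -> 1 - x * p ^+ i != 0) ->
  qpoch x p k != 0.
Proof. by move=> nz; apply/prodf_neq0 => i _; apply: nz. Qed.

Lemma qpoch_eq0 x p k i : (i < k)%N -> x * p ^+ i = 1 -> qpoch x p k = 0.
Proof. by move=> ik xp; rewrite /qpoch (bigD1 (Ordinal ik)) //= xp subrr mul0r. Qed.

Lemma qpochVXn p k n : p != 0 -> (n < k)%N -> qpoch (p ^- n) p k = 0.
Proof. by move=> p0 nk; apply: (@qpoch_eq0 _ _ _ n) => //; rewrite mulVf // expf_neq0. Qed.

(** The q-Pfaff-Saalschuetz sum for a terminating balanced 3phi2, cleared of denominators. The
    induction on [n] replaces [y] by [y * p], which preserves the balancing condition; creative
    telescoping links the two sums. *)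
Lemma qSaalschutz p a b c y n :
  p != 0 -> a != 0 -> b != 0 -> c != 0 -> c * y * p ^+ n = a * b * p ->
  (forall i, 1 - p ^+ i.+1 != 0) -> (forall i, 1 - c * p ^+ i != 0) ->
  (forall i, 1 - y * p ^+ i != 0) ->
  (\sum_(j < n.+1) qpoch a p j * qpoch b p j * qpoch (p ^- n) p j
      / (qpoch p p j * qpoch c p j * qpoch y p j) * p ^+ j)
    * (qpoch c p n * qpoch (c / (a * b)) p n)
  = qpoch (c / a) p n * qpoch (c / b) p n.
Proof.
move=> p0 a0 b0 c0 + pn0 cn0; elim: n y => [|n IH] y ey yn0.
  by rewrite big_ord1 !qpoch0 !expr0 !(mulr1, divr1).
have Q0 : p ^+ n != 0 by rewrite expf_neq0.
have y0 : y != 0.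
  apply/eqP => y0; move/eqP: ey; rewrite y0 mulr0 mul0r eq_sym !mulf_eq0.
  by rewrite (negPf a0) (negPf b0) (negPf p0).
have eyp : c * (y * p) * p ^+ n = a * b * p by rewrite -ey exprS; ring.
have ypn0 i : 1 - y * p * p ^+ i != 0 by rewrite -mulrA -exprS.
have ey' : y = a * b / (c * p ^+ n).
  apply: (mulIf p0); apply: (mulfI c0); apply: (mulIf Q0).
  by rewrite eyp; field; rewrite c0 Q0.
have {IH} := IH _ eyp ypn0.
set t := fun j => qpoch a p j * qpoch b p j * qpoch (p ^- n) p j
   / (qpoch p p j * qpoch c p j * qpoch (y * p) p j) * p ^+ j.
set u := fun j => qpoch a p j * qpoch b p j * qpoch (p ^- n.+1) p j
   / (qpoch p p j * qpoch c p j * qpoch y p j) * p ^+ j.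
pose X := c * p ^+ n.
(* The telescoping certificate: the combination of [u] and [t] in [W] has partial sums [g k], and
   [g n.+1] vanishes through [(p^-n)_(n+1)], which leaves a first-order recurrence in [n]. *)
pose g j := - (X / (a * b)) * (qpoch a p j.+1 * qpoch b p j.+1
  * qpoch (p ^- n) p j) / (qpoch p p j * qpoch c p j * qpoch (y * p) p j).
have W k : \sum_(j < k.+1) ((1 - X) * (1 - X / (a * b)) * u j
     - (1 - X / a) * (1 - X / b) * t j) = g k.
  elim: k => [|k IHk].
    rewrite big_ord1 /u /t /g !qpochS !qpoch0 !expr0 !mulr1 !mul1r invr1 /X.
    by field; rewrite a0 b0.
  rewrite big_ord_recr /= IHk /g /u /t.
  have -> : qpoch y p k.+1 = (1 - y) * qpoch (y * p) p k by rewrite qpochSl.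
  have -> : qpoch (p ^- n.+1) p k.+1 = (1 - p ^- n.+1) * qpoch (p ^- n) p k.
    rewrite qpochSl; congr (_ * qpoch _ _ _).
    by rewrite exprS; field; rewrite Q0 p0.
  rewrite !(qpochS _ _ k.+1) !(qpochS _ _ k) !exprS /X.
  have := yn0 0%N; rewrite expr0 mulr1.
  have := yn0 k.+1; have := cn0 k; have := pn0 k; rewrite !exprS.
  have := @qpoch_neq0 _ _ k (fun i _ => ypn0 i).
  have := @qpoch_neq0 _ _ k (fun i _ => cn0 i).
  have : qpoch p p k != 0 by apply: qpoch_neq0 => i _; rewrite -exprS.
  move: (qpoch p p k) (qpoch c p k) (qpoch (y * p) p k) (qpoch a p k)
    (qpoch b p k) (qpoch (p ^- n) p k) => qp qc qy qa qb qn.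
  rewrite ey'; move: (p ^+ k) (p ^+ n) Q0 => P Q Q0 h1 h2 h3 h4 h5 h6 h7.
  field; rewrite a0 b0 c0 Q0 h1 h2 h3 h4 h5 /=; apply/andP; split.
    (* Since [y = a * b / (c * Q)], the denominators left by [field] are [1 - y * (p * P)] and
       [1 - y], up to the factor [c * Q]. *)
    have -> : c * Q - a * b * p * P
      = (1 - a * b / (c * Q) * (p * P)) * (c * Q) by field; rewrite Q0.
    by rewrite !mulf_neq0.
  have -> : c * Q - a * b = (1 - a * b / (c * Q)) * (c * Q) by field; rewrite Q0.
  by rewrite !mulf_neq0.
have g0 : g n.+1 = 0 by rewrite /g [qpoch (p ^- n) p _]qpochVXn // !(mulr0, mul0r).
have t0 : t n.+1 = 0 by rewrite /t qpochVXn // !(mulr0, mul0r).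
have := W n.+1; rewrite g0 big_split /= sumrN -!mulr_sumr => /eqP.
rewrite subr_eq0 => /eqP E.
rewrite [\sum_(j < n.+2) t j]big_ord_recr /= t0 addr0 in E.
move: E; move: (\sum_(j < _) _) => S1; move: (\sum_(j < _) _) => S0 E1 E0.
rewrite !qpochS.
have -> : c / (a * b) * p ^+ n = X / (a * b) by rewrite /X; ring.
have -> : c / a * p ^+ n = X / a by rewrite /X; ring.
have -> : c / b * p ^+ n = X / b by rewrite /X; ring.
rewrite -/X [RHS]mulrACA -E0.
transitivity ((1 - X) * (1 - X / (a * b)) * S1 * (qpoch c p n * qpoch (c / (a * b)) p n));
  first by ring.
by rewrite E1; ring.
Qed.

(** The terminating very-well-poised 6phi5 sum, multiplied by [1 - A]: this removes the usual
    denominator [1 - A] of the summand and turns [(Ap)_n] into [(A)_(n+1)] on the right. The proof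
    is again creative telescoping in [n]. *)
Lemma very_well_poised_6phi5 p A d e n :
  p != 0 -> d != 0 -> e != 0 ->
  (forall i, 1 - p ^+ i.+1 != 0) -> (forall i, 1 - A * p / d * p ^+ i != 0) ->
  (forall i, 1 - A * p / e * p ^+ i != 0) ->
  (forall i, 1 - A * p ^+ i.+1 != 0) ->
  (\sum_(i < n.+1) (1 - A * p ^+ (2 * i)) * (qpoch A p i * qpoch d p i
      * qpoch e p i * qpoch (p ^- n) p i)
      / (qpoch p p i * qpoch (A * p / d) p i * qpoch (A * p / e) p i
         * qpoch (A * p ^+ n.+1) p i) * (A * p ^+ n.+1 / (d * e)) ^+ i)
    * (qpoch (A * p / d) p n * qpoch (A * p / e) p n)
  = qpoch A p n.+1 * qpoch (A * p / (d * e)) p n.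
Proof.
move=> p0 d0 e0 pn0 dn0 en0 An0; elim: n => [|n].
  by rewrite big_ord1 muln0 !qpochS !qpoch0 !expr0 !(mulr1, mul1r, invr1).
have Q0 : p ^+ n != 0 by rewrite expf_neq0.
set t := fun i => (1 - A * p ^+ (2 * i)) * (qpoch A p i * qpoch d p i
      * qpoch e p i * qpoch (p ^- n) p i)
      / (qpoch p p i * qpoch (A * p / d) p i * qpoch (A * p / e) p i
         * qpoch (A * p ^+ n.+1) p i) * (A * p ^+ n.+1 / (d * e)) ^+ i.
set u := fun i => (1 - A * p ^+ (2 * i)) * (qpoch A p i * qpoch d p i
      * qpoch e p i * qpoch (p ^- n.+1) p i)
      / (qpoch p p i * qpoch (A * p / d) p i * qpoch (A * p / e) p i
         * qpoch (A * p ^+ n.+2) p i) * (A * p ^+ n.+2 / (d * e)) ^+ i.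
pose X := A * p ^+ n.+1; pose w := X / (d * e).
(* The certificate; it too vanishes at [n.+1] through [(p^-n)_(n+1)]. *)
pose g i := w * (qpoch A p i.+1 * qpoch d p i.+1 * qpoch e p i.+1
    * qpoch (p ^- n) p i) / (qpoch p p i * qpoch (A * p / d) p i
      * qpoch (A * p / e) p i * qpoch (A * p ^+ n.+2) p i) * w ^+ i.
have W k : \sum_(i < k.+1) ((1 - X / d) * (1 - X / e) * u i
     - (1 - X) * (1 - w) * t i) = g k.
  elim: k => [|k IHk].
    rewrite big_ord1 /u /t /g /w /X muln0 !qpochS !qpoch0 !expr0 !mulr1 !mul1r invr1.
    by field; rewrite d0 e0.
  rewrite big_ord_recr /= IHk /g /u /t.
  have -> : qpoch (A * p ^+ n.+1) p k.+1 = (1 - A * p ^+ n.+1) * qpoch (A * p ^+ n.+2) p k.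
    by rewrite qpochSl -mulrA -exprSr.
  have -> : qpoch (p ^- n.+1) p k.+1 = (1 - p ^- n.+1) * qpoch (p ^- n) p k.
    rewrite qpochSl; congr (_ * qpoch _ _ _).
    by rewrite exprS; field; rewrite Q0 p0.
  have -> : A * p ^+ n.+2 / (d * e) = p * w by rewrite /w /X exprS; ring.
  rewrite -/X -/w [(p * w) ^+ _]exprMn ![w ^+ k.+1]exprS.
  rewrite !(qpochS _ _ k.+1) !(qpochS _ _ k) mulnS exprD mulnC exprM.
  move: (w ^+ k) => wk.
  rewrite /w /X !(exprSr p k) !(exprSr p n).
  have := An0 n; have := An0 (n + k).+1; have := en0 k; have := dn0 k; have := pn0 k.
  have : qpoch (A * p ^+ n.+2) p k != 0.
    by apply: qpoch_neq0 => i _; rewrite -mulrA -exprD addSn.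
  have := @qpoch_neq0 _ _ k (fun i _ => dn0 i).
  have := @qpoch_neq0 _ _ k (fun i _ => en0 i).
  have : qpoch p p k != 0 by apply: qpoch_neq0 => i _; rewrite -exprS.
  rewrite !(exprSr p n.+1) !(exprSr p (n + k).+1) !(exprSr p (n + k)).
  rewrite !(exprSr p n) !(exprSr p k) exprD.
  move: (qpoch p p k) (qpoch (A * p / d) p k) (qpoch (A * p / e) p k) (qpoch d p k)
    (qpoch A p k) (qpoch e p k) (qpoch (p ^- n) p k)
    (qpoch (A * (p ^+ n * p * p)) p k) => qp qAd qAe qd qA qe qn qX.
  move: (p ^+ k) (p ^+ n) Q0 => P Q Q0 h1 h2 h3 h4 h5 h6 h7 h8 h9.
  have eA : 1 - A * (Q * p * p) * P = 1 - A * (Q * P * p * p) by ring.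
  have eD : d - A * p * P = (1 - A * p / d * P) * d by field; rewrite d0.
  have eE : e - A * p * P = (1 - A * p / e * P) * e by field; rewrite e0.
  field; rewrite eA eD eE !mulf_neq0 // d0 e0 p0 Q0 h1 h2 h3 h4 h8 h9 /=.
  by rewrite mulrC h5.
have g0 : g n.+1 = 0 by rewrite /g [qpoch (p ^- n) p _]qpochVXn // !(mulr0, mul0r).
have t0 : t n.+1 = 0 by rewrite /t qpochVXn // !(mulr0, mul0r).
have := W n.+1; rewrite g0 big_split /= sumrN -!mulr_sumr => /eqP.
rewrite subr_eq0 => /eqP E.
rewrite [\sum_(j < n.+2) t j]big_ord_recr /= t0 addr0 in E.
move: E; move: (\sum_(j < _) _) => S1; move: (\sum_(j < _) _) => S0 E1 E0.
rewrite !(qpochS (_ / _) _ n) (qpochS A p n.+1).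
have -> : A * p / (d * e) * p ^+ n = w by rewrite /w /X exprS; ring.
have -> : A * p / d * p ^+ n = X / d by rewrite /X exprS; ring.
have -> : A * p / e * p ^+ n = X / e by rewrite /X exprS; ring.
rewrite -/X [RHS]mulrACA -E0.
transitivity ((1 - X / d) * (1 - X / e) * S1
  * (qpoch (A * p / d) p n * qpoch (A * p / e) p n)); first by ring.
by rewrite E1; ring.
Qed.

(** Read the product from its last factor, writing each [1 - y] as [- y * (1 - 1 / y)]. *)
Lemma qpoch_rev x p k : p != 0 -> x != 0 ->
  qpoch x p k = (- x) ^+ k * p ^+ 'C(k, 2) * qpoch (p / (x * p ^+ k)) p k.
Proof.
move=> p0 x0; elim: k => [|k IH]; first by rewrite !qpoch0 !mulr1.
have xk : x * p ^+ k != 0 by rewrite mulf_neq0 ?expf_neq0.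
rewrite qpochS IH qpochSl binS bin1 exprD !exprS.
have -> : p / (x * (p * p ^+ k)) = (x * p ^+ k)^-1.
  by rewrite mulrCA invfM mulrA divff // mul1r.
rewrite -[p / (x * p ^+ k)]mulrC; move: (qpoch _ p k) => qk.
by field; rewrite x0 expf_neq0.
Qed.

(** Saalschuetz with upper parameters [Ap/(bc)], [A p^k] and lower ones [Ap/b], [Ap/c]; reversing
    the products based at [p/(b p^k)] and [c/(A p^k)] restores [(b)_k] and [(Ap/c)_k]. It trades [b]
    and [c] for an inner sum in Watson's transformation. *)
Lemma qSaalschutz_wp p A b c k :
  p != 0 -> A != 0 -> b != 0 -> c != 0 ->
  (forall i, 1 - p ^+ i.+1 != 0) -> (forall i, 1 - A * p / b * p ^+ i != 0) ->
  (forall i, 1 - A * p / c * p ^+ i != 0) ->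
  qpoch b p k * qpoch c p k / (qpoch (A * p / b) p k * qpoch (A * p / c) p k)
    * (A * p / (b * c)) ^+ k
  = \sum_(j < k.+1) qpoch (A * p / (b * c)) p j * qpoch (A * p ^+ k) p j
      * qpoch (p ^- k) p j
      / (qpoch p p j * qpoch (A * p / b) p j * qpoch (A * p / c) p j) * p ^+ j.
Proof.
move=> p0 A0 b0 c0 pn0 bn0 cn0.
have u0 : A * p / (b * c) != 0 by rewrite !(mulf_neq0, invr_neq0).
have P0 : p ^+ k != 0 by rewrite expf_neq0.
have Ak0 : A * p ^+ k != 0 by rewrite mulf_neq0.
have B0 : A * p / b != 0 by rewrite !(mulf_neq0, invr_neq0).
have ey : A * p / b * (A * p / c) * p ^+ k = A * p / (b * c) * (A * p ^+ k) * p.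
  by field; rewrite b0 c0.
have := qSaalschutz p0 u0 Ak0 B0 ey pn0 bn0 cn0.
have -> : A * p / b / (A * p / (b * c) * (A * p ^+ k)) = c / (A * p ^+ k).
  by field; rewrite A0 b0 c0 p0 P0.
have -> : A * p / b / (A * p / (b * c)) = c by field; rewrite A0 b0 c0 p0.
have -> : A * p / b / (A * p ^+ k) = p / (b * p ^+ k) by field; rewrite A0 b0 P0.
move: (\sum_(j < k.+1) _) => S.
have eC : c / (A * p ^+ k) = p / (A * p / c * p ^+ k) by field; rewrite A0 c0 p0 P0.
have C0 : A * p / c != 0 by rewrite !(mulf_neq0, invr_neq0).
have x1 : (- b) ^+ k * (A * p / (b * c)) ^+ k = (- (A * p / c)) ^+ k.
  by rewrite -exprMn; congr (_ ^+ _); field; rewrite b0 c0.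
rewrite eC (@qpoch_rev b p) // (@qpoch_rev (A * p / c) p) //.
have bn1 := @qpoch_neq0 _ _ k (fun i _ => bn0 i).
have := @qpoch_neq0 _ _ k (fun i _ => cn0 i).
rewrite (@qpoch_rev (A * p / c) p) // -x1.
rewrite !mulf_eq0 !negb_or => /andP[/andP[/andP[h1 h1'] h2] h3].
move: (qpoch _ p k) (qpoch _ p k) (qpoch _ p k) (qpoch _ p k) bn1 h3 => q1 q2 q3 q4.
move=> h4 h5 E.
move: ((- b) ^+ k) ((A * p / (b * c)) ^+ k) (p ^+ 'C(k, 2)) h1 h1' h2 => v1 v2 v3 *.
apply: (mulIf (mulf_neq0 h4 h5)); rewrite E.
by field; repeat (apply/andP; split => //).
Qed.

(** Reversing [(p^-(j+i))_j] gives the last [j] factors of [(p)_(j+i)]. *)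
Lemma qpochVXnD p i j : p != 0 ->
  qpoch (p ^- (j + i)) p j * qpoch p p i
  = (- 1) ^+ j * p ^+ 'C(j, 2) * p ^- (j + i) ^+ j * qpoch p p (j + i).
Proof.
move=> p0; have P0 k : p ^+ k != 0 by rewrite expf_neq0.
rewrite (@qpoch_rev (p ^- _)) ?invr_neq0 // [(j + i)%N]addnC qpochD.
have -> : p / (p ^- (i + j) * p ^+ j) = p * p ^+ i.
  by rewrite exprD; field; rewrite !P0 oner_eq0.
rewrite [in LHS]exprNn -!mulrA; congr (_ * _); rewrite mulrCA; congr (_ * (_ * _)).
exact: mulrC.
Qed.

Lemma sqr_bin2 j : (j * j = j + 2 * 'C(j, 2))%N.
Proof. by elim: j => // j; rewrite binS bin1 mulSn mulnS; lia. Qed.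

(** By [j^2 = j + 2 C(j,2)], the power factor of Watson's double sum splits into a part in [j] and a
    geometric part in [i]. *)
Lemma watson_power p z i j : p != 0 ->
  (- 1) ^+ j * p ^+ 'C(j, 2) * p ^- (j + i) ^+ j * z ^+ (j + i) * p ^+ j
  = (- z) ^+ j / p ^+ 'C(j, 2) * (z / p ^+ j) ^+ i.
Proof.
move=> p0; have P0 k : p ^+ k != 0 by rewrite expf_neq0.
rewrite expr_div_n [in RHS]exprNn exprVn -!exprM exprD mulnDl.
rewrite sqr_bin2 mul2n -addnn [(j * i)%N]mulnC !exprD.
by field; rewrite !P0.
Qed.

(* Expand (b)_k (c)_k by Saalschuetz; the sum over k is then a 6phi5. *)
Lemma qWatson p A b c d e m :
  p != 0 -> A != 0 -> b != 0 -> c != 0 -> d != 0 -> e != 0 ->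
  (forall i, 1 - p ^+ i.+1 != 0) -> (forall i, 1 - A * p ^+ i.+1 != 0) ->
  (forall i, 1 - A * p / b * p ^+ i != 0) ->
  (forall i, 1 - A * p / c * p ^+ i != 0) ->
  (forall i, 1 - A * p / d * p ^+ i != 0) ->
  (forall i, 1 - A * p / e * p ^+ i != 0) ->
  (\sum_(k < m.+1) (1 - A * p ^+ (2 * k)) *
     (qpoch A p k * qpoch b p k * qpoch c p k * qpoch d p k * qpoch e p k
       * qpoch (p ^- m) p k)
     / (qpoch p p k * qpoch (A * p / b) p k * qpoch (A * p / c) p k
       * qpoch (A * p / d) p k * qpoch (A * p / e) p k * qpoch (A * p ^+ m.+1) p k)
     * (A ^+ 2 * p ^+ m.+2 / (b * c * d * e)) ^+ k)
   * (qpoch (A * p / d) p m * qpoch (A * p / e) p m)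
  = qpoch A p m.+1 *
    \sum_(j < m.+1) qpoch (A * p / (b * c)) p j * qpoch (A * p / (d * e)) p (m - j)
      * (qpoch d p j * qpoch e p j * qpoch (p ^- m) p j)
      / (qpoch p p j * qpoch (A * p / b) p j * qpoch (A * p / c) p j)
      * ((- (A * p ^+ m.+1 / (d * e))) ^+ j / p ^+ 'C(j, 2)).
Proof.
move=> p0 A0 b0 c0 d0 e0 pn0 An0 bn0 cn0 dn0 en0.
have P0 k : p ^+ k != 0 by rewrite expf_neq0.
have pk0 k : qpoch p p k != 0 by apply: qpoch_neq0 => i _; rewrite -exprS.
have bk0 k := @qpoch_neq0 _ _ k (fun i _ => bn0 i).
have ck0 k := @qpoch_neq0 _ _ k (fun i _ => cn0 i).
have dk0 k := @qpoch_neq0 _ _ k (fun i _ => dn0 i).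
have ek0 k := @qpoch_neq0 _ _ k (fun i _ => en0 i).
have Ak0 k : qpoch (A * p ^+ m.+1) p k != 0.
  by apply: qpoch_neq0 => i _; rewrite -mulrA -exprD addSn.
pose z := A * p ^+ m.+1 / (d * e).
(* Summand of the double sum. It vanishes for [j > k] through [(p^-k)_j], so both indices may run up
   to [m]. *)
pose H k j := (1 - A * p ^+ (2 * k)) *
     (qpoch A p k * qpoch d p k * qpoch e p k * qpoch (p ^- m) p k)
     / (qpoch p p k * qpoch (A * p / d) p k * qpoch (A * p / e) p k
       * qpoch (A * p ^+ m.+1) p k) * z ^+ k
     * (qpoch (A * p / (b * c)) p j * qpoch (A * p ^+ k) p j * qpoch (p ^- k) p j
      / (qpoch p p j * qpoch (A * p / b) p j * qpoch (A * p / c) p j) * p ^+ j).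
rewrite (eq_bigr (fun k : 'I_m.+1 => \sum_(j < m.+1) H k j)); last first.
  move=> k _; rewrite -mulr_sumr.
  have -> : \sum_(j < m.+1) (qpoch (A * p / (b * c)) p j * qpoch (A * p ^+ k) p j
      * qpoch (p ^- k) p j
      / (qpoch p p j * qpoch (A * p / b) p j * qpoch (A * p / c) p j) * p ^+ j)
    = \sum_(j < k.+1) (qpoch (A * p / (b * c)) p j * qpoch (A * p ^+ k) p j
      * qpoch (p ^- k) p j
      / (qpoch p p j * qpoch (A * p / b) p j * qpoch (A * p / c) p j) * p ^+ j).
    rewrite [RHS](big_ord_widen m.+1 (fun j => qpoch (A * p / (b * c)) p j
      * qpoch (A * p ^+ k) p j * qpoch (p ^- k) p j
      / (qpoch p p j * qpoch (A * p / b) p j * qpoch (A * p / c) p j) * p ^+ j)) //.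
    rewrite [RHS]big_mkcond /=; apply: eq_bigr => j _; case: ifP => // /negbT.
    by rewrite ltnS -ltnNge => kj; rewrite (@qpochVXn p j k) // !(mulr0, mul0r).
  rewrite -qSaalschutz_wp //.
  have -> : A ^+ 2 * p ^+ m.+2 / (b * c * d * e) = z * (A * p / (b * c)).
by rewrite /z (exprS p m.+1); field; rewrite b0 c0 d0 e0.
  rewrite exprMn; move: (z ^+ k) (_ ^+ k) => z1 z2.
  have := pk0 k; have := bk0 k; have := ck0 k; have := dk0 k; have := ek0 k.
  have := Ak0 k.
  move: (qpoch _ _ k) (qpoch _ _ k) (qpoch _ _ k) (qpoch _ _ k) (qpoch _ _ k)
   (qpoch _ _ k) (qpoch _ _ k) (qpoch _ _ k) (qpoch _ _ k) (qpoch _ _ k)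
   (qpoch _ _ k) => *.
  by field; repeat (apply/andP; split => //).
(* For fixed [j] the sum over [k] starts at [j]. With [k = i + j] and [n = m - j] it is a constant
   [C] times a 6phi5 with the parameters [A'], [d'], [e'] below. *)
rewrite exchange_big /= mulr_suml mulr_sumr; apply: eq_bigr => -[j /= jm] _.
have [n nj] : exists n, m = (j + n)%N by exists (m - j)%N; rewrite subnKC // -ltnS.
rewrite nj addKn -addnS -(big_mkord xpredT (fun k => H k j)).
rewrite (big_cat_nat (n := j)) ?leq_addr //= big1_seq ?add0r; last first.
  move=> k; rewrite mem_index_iota => /andP[_ kj].
  by rewrite /H (@qpochVXn p j k) // !(mulr0, mul0r).
rewrite -{1}[j]add0n big_addn addKn big_mkord.
pose C := qpoch (A * p / (b * c)) p j / (qpoch p p j * qpoch (A * p / b) p j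
    * qpoch (A * p / c) p j) * qpoch A p (2 * j) * (qpoch d p j * qpoch e p j
    * qpoch (p ^- m) p j) / (qpoch (A * p / d) p j * qpoch (A * p / e) p j
    * qpoch (A * p ^+ m.+1) p j) * ((- z) ^+ j / p ^+ 'C(j, 2)).
pose A' := A * p ^+ (2 * j); pose d' := d * p ^+ j; pose e' := e * p ^+ j.
pose t i := (1 - A' * p ^+ (2 * i)) * (qpoch A' p i * qpoch d' p i
      * qpoch e' p i * qpoch (p ^- n) p i)
      / (qpoch p p i * qpoch (A' * p / d') p i * qpoch (A' * p / e') p i
         * qpoch (A' * p ^+ n.+1) p i) * (A' * p ^+ n.+1 / (d' * e')) ^+ i.
have eD : A' * p / d' = A * p / d * p ^+ j.
  by rewrite /A' /d' mulnC exprM; field; rewrite d0 P0.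
have eE : A' * p / e' = A * p / e * p ^+ j.
  by rewrite /A' /e' mulnC exprM; field; rewrite e0 P0.
have HE i : H (i + j)%N j = C * t i.
  rewrite /H /C /t eD eE.
  have -> : A' * p ^+ n.+1 / (d' * e') = z / p ^+ j.
    rewrite /A' /d' /e' /z nj mulnC exprM -addnS exprD.
    by field; rewrite d0 e0 P0.
  have -> : A' * p ^+ n.+1 = A * p ^+ m.+1 * p ^+ j.
    by rewrite /A' nj -!mulrA -!exprD; congr (_ * _ ^+ _); lia.
  have -> : A' * p ^+ (2 * i) = A * p ^+ (2 * (i + j)).
    by rewrite /A' -!mulrA -!exprD; congr (_ * _ ^+ _); lia.
  rewrite [(i + j)%N]addnC.
  (* Both sides are [(A)_(2j+i)]: the factor [(A p^k)_j] from Saalschuetz extends [(A)_k]. *)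
  have EA : qpoch A p (j + i) * qpoch (A * p ^+ (j + i)) p j
      = qpoch A p (2 * j) * qpoch A' p i.
    by rewrite -!qpochD; congr (qpoch _ _ _); lia.
  pose s := (- 1) ^+ j * p ^+ 'C(j, 2) * p ^- (j + i) ^+ j.
  have ER : qpoch (p ^- (j + i)) p j = s * qpoch p p (j + i) / qpoch p p i.
    by rewrite /s -qpochVXnD // mulfK.
  have EP : s * z ^+ (j + i) * p ^+ j = (- z) ^+ j / p ^+ 'C(j, 2) * (z / p ^+ j) ^+ i.
    exact: watson_power.
  have EM : qpoch (p ^- m) p (j + i) = qpoch (p ^- m) p j * qpoch (p ^- n) p i.
    rewrite qpochD; congr (_ * qpoch _ _ _).
    by rewrite nj exprD; field; rewrite !P0.
  have := pk0 i; have := pk0 j; have := bk0 j; have := ck0 j.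
  have := Ak0 (j + i)%N; have := dk0 (j + i)%N; have := ek0 (j + i)%N.
  have := pk0 (j + i)%N.
  rewrite ER EM !(qpochD (A * p / _)) !(qpochD (A * p ^+ _)) !(qpochD d) !(qpochD e).
  rewrite !mulf_eq0 !negb_or => h1 /andP[h2 h2'] /andP[h3 h3'] /andP[h4 h4'] h5 h6 h7 h8.
  transitivity ((1 - A * p ^+ (2 * (j + i))) * qpoch (A * p / (b * c)) p j
    * (qpoch A p (j + i) * qpoch (A * p ^+ (j + i)) p j)
    * (qpoch d p j * qpoch (d * p ^+ j) p i * (qpoch e p j * qpoch (e * p ^+ j) p i)
       * (qpoch (p ^- m) p j * qpoch (p ^- n) p i))
    / (qpoch p p i * qpoch p p j * qpoch (A * p / b) p j * qpoch (A * p / c) p j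
       * (qpoch (A * p / d) p j * qpoch (A * p / d * p ^+ j) p i)
       * (qpoch (A * p / e) p j * qpoch (A * p / e * p ^+ j) p i)
       * (qpoch (A * p ^+ m.+1) p j * qpoch (A * p ^+ m.+1 * p ^+ j) p i))
    * (s * z ^+ (j + i) * p ^+ j)).
    rewrite (qpochD A); field; repeat (apply/andP; split => //).
  rewrite EA EP; field; repeat (apply/andP; split => //).
rewrite (eq_bigr (fun i : 'I_n.+1 => C * t i)); last by move=> i _; apply: HE.
rewrite -mulr_sumr.
have d'0 : d' != 0 by rewrite mulf_neq0.
have e'0 : e' != 0 by rewrite mulf_neq0.
have dn' i : 1 - A' * p / d' * p ^+ i != 0 by rewrite eD -mulrA -exprD.
have en' i : 1 - A' * p / e' * p ^+ i != 0 by rewrite eE -mulrA -exprD.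
have An' i : 1 - A' * p ^+ i.+1 != 0 by rewrite /A' -mulrA -exprD addnS.
have S : (\sum_(i < n.+1) t i) * (qpoch (A' * p / d') p n * qpoch (A' * p / e') p n)
  = qpoch A' p n.+1 * qpoch (A' * p / (d' * e')) p n
  := very_well_poised_6phi5 n p0 d'0 e'0 pn0 dn' en' An'.
have eDE : A' * p / (d' * e') = A * p / (d * e).
  by rewrite /A' /d' /e' mulnC exprM; field; rewrite d0 e0 P0.
rewrite eD eE eDE in S.
have EA : qpoch A p (j + n.+1) = qpoch A p (2 * j) * qpoch A' p n.+1
    / qpoch (A * p ^+ m.+1) p j.
  apply: (mulIf (Ak0 j)); rewrite divfK // nj -addnS -!qpochD.
  by congr (qpoch _ _ _); lia.
rewrite addnS -nj in EA *; rewrite -/z EA [in LHS]nj !(qpochD (A * p / _) p j n).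
transitivity (C * (qpoch (A * p / d) p j * qpoch (A * p / e) p j) *
  ((\sum_(i < n.+1) t i) * (qpoch (A * p / d * p ^+ j) p n
     * qpoch (A * p / e * p ^+ j) p n))); first by ring.
rewrite S /C.
have := dk0 j; have := ek0 j; have := Ak0 j; have := pk0 j; have := bk0 j.
have := ck0 j.
move: ((- z) ^+ j) => zj.
by move=> *; field; repeat (apply/andP; split => //).
Qed.

End QPoch.

(** * Well-poised reflection *)

Section WellPoised.
Context {F : fieldType}.
Implicit Types (p A : F) (x : 'I_6 -> F).

(** When [A] is among the [x r], [wpterm] is the summand of a very-well-poised 8phi7 up to
    normalization by [1 - A]. Leaving all six parameters free makes the family stable under shifts
    of the index. *)
Definition wpratio p A x k : F :=
  \prod_r (qpoch (x r) p k / qpoch (A * p / x r) p k)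
    * (A ^+ 3 * p ^+ 2 / \prod_r x r) ^+ k.

Definition wpterm p A x k : F := (1 - A * p ^+ (2 * k)) * wpratio p A x k.

(** The shift turns [Ap/x] into [(Ap/x) p^k] and fixes the argument, since [A^3] and the product of
    the six parameters both gain [p^(6k)]. *)
Lemma wpratioD p A x k l : p != 0 -> (forall r, x r != 0) ->
  wpratio p A x (k + l)
  = wpratio p A x k * wpratio p (A * p ^+ (2 * k)) (fun r => x r * p ^+ k) l.
Proof.
move=> p0 x0; have P0 : p ^+ k != 0 by rewrite expf_neq0.
have -> : wpratio p (A * p ^+ (2 * k)) (fun r => x r * p ^+ k) l
  = \prod_r (qpoch (x r * p ^+ k) p l / qpoch (A * p / x r * p ^+ k) p l)
    * (A ^+ 3 * p ^+ 2 / \prod_r x r) ^+ l.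
  congr (_ * _ ^+ _).
    apply: eq_bigr => r _; congr (_ / qpoch _ _ _).
    by rewrite mulnC exprM; field; rewrite x0 P0.
  have X0 : \prod_r x r != 0 by apply/prodf_neq0.
  rewrite big_split /= prodr_const card_ord mulnC exprM.
  by field; rewrite X0 P0.
rewrite /wpratio exprD  [RHS]mulrACA -big_split /=; congr (_ * _).
by apply: eq_bigr => r _; rewrite !qpochD invfM mulrACA.
Qed.

(* The reflection k -> m - k, which exists because A = p^-m. *)
Lemma qpoch_reflect p (y : F) m k : p != 0 -> y != 0 -> (k <= m)%N ->
  qpoch (p ^- m * p / y) p m != 0 ->
  qpoch y p (m - k) / qpoch (p ^- m * p / y) p (m - k)
    * ((- y) ^+ k * p ^+ 'C(k, 2))
  = qpoch y p k / qpoch (p ^- m * p / y) p k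
    * ((- y) ^+ (m - k) * p ^+ 'C(m - k, 2)).
Proof.
move=> p0 y0 km Y0; have P0 i : p ^+ i != 0 by rewrite expf_neq0.
(* Split off the last [i] factors of [(y)_m] and reverse them. This is used for [i = k] and
   [i = m - k], for which the power [p^((m-i)i)] is the same. *)
have H i : (i <= m)%N -> qpoch y p (m - i) * qpoch (p ^- m * p / y) p i
   * ((- y) ^+ i * p ^+ 'C(i, 2)) * p ^+ ((m - i) * i) = qpoch y p m.
  move=> im; rewrite -{4}(subnK im) qpochD (@qpoch_rev _ (y * _)) ?mulf_neq0 //.
  rewrite -mulNr exprMn -exprM.
  have -> : p / (y * p ^+ (m - i) * p ^+ i) = p ^- m * p / y.
    by rewrite -mulrA -exprD subnK //; field; rewrite y0 P0.
  by ring.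
have Yn0 i : (i <= m)%N -> qpoch (p ^- m * p / y) p i != 0.
  by move=> im; move: Y0; rewrite -(subnKC im) qpochD subnKC // mulf_eq0 negb_or => /andP[].
have := H _ (leq_subr k m); rewrite -(H _ km) subKn // [(k * _)%N]mulnC => /(mulIf (P0 _)) E.
have h1 := Yn0 _ km; have h2 := Yn0 _ (leq_subr k m).
apply: (mulIf h1); apply: (mulIf h2); move: E.
move: ((- y) ^+ k * _) ((- y) ^+ _ * _) => s1 s2.
move: (qpoch y p k) (qpoch _ p k) (qpoch y p (m - k)) (qpoch _ p (m - k)) h1 h2.
move=> q1 q2 q3 q4 h1 h2 E.
transitivity (q3 * q2 * s1); first by field.
by rewrite -E; field.
Qed.

(** Over six parameters the signs in [qpoch_reflect] disappear, and [wpratio] times [p^k] is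
    invariant under the reflection. The minus sign comes from
    [(1 - p^(2k-m)) p^(m-k) = p^(m-k) - p^k], which is antisymmetric. *)
Lemma wpterm_reflect p x m k : p != 0 -> (forall r, x r != 0) -> (k <= m)%N ->
  (forall r, qpoch (p ^- m * p / x r) p m != 0) ->
  wpterm p (p ^- m) x (m - k) = - wpterm p (p ^- m) x k.
Proof.
move=> p0 x0 km Y0; have P0 i : p ^+ i != 0 by rewrite expf_neq0.
have X0 : \prod_r x r != 0 by apply/prodf_neq0.
have Hprod i : \prod_(r < 6) ((- x r) ^+ i * p ^+ 'C(i, 2))
   = (\prod_r x r) ^+ i * p ^+ 'C(i, 2) ^+ 6.
  rewrite big_split /= prodr_const card_ord prodrXl prodrN card_ord.
  by rewrite -signr_odd mul1r.
have E : wpratio p (p ^- m) x (m - k) * p ^+ (m - k)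
   = wpratio p (p ^- m) x k * p ^+ k.
  have : \prod_r (qpoch (x r) p (m - k) / qpoch (p ^- m * p / x r) p (m - k))
         * \prod_(r < 6) ((- x r) ^+ k * p ^+ 'C(k, 2))
    = \prod_r (qpoch (x r) p k / qpoch (p ^- m * p / x r) p k)
         * \prod_(r < 6) ((- x r) ^+ (m - k) * p ^+ 'C(m - k, 2)).
    by rewrite -!big_split; apply: eq_bigr => r _; apply: qpoch_reflect.
  rewrite !Hprod /wpratio.
  move: (\prod_r (_ / _)) (\prod_r (_ / _)) => R1 R2.
  move: (\prod_r _) X0 => X X0 H.
  (* The exponent is [-3mi + 2i + i + 6 C(i,2) = -3(m-i)i], symmetric in [i] and [m - i]. *)
  have HZ i : (i <= m)%N -> (p ^- m ^+ 3 * p ^+ 2) ^+ i * p ^+ i * p ^+ 'C(i, 2) ^+ 6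
     = p ^- (3 * ((m - i) * i)).
    move=> im; apply: (mulIf (P0 (3 * ((m - i) * i))%N)); rewrite mulVf //.
    rewrite !exprVn exprMn exprVn -!exprM -!mulrA -!exprD; apply: (canLR (mulKf (P0 _))).
    rewrite mulr1; congr (_ ^+ _); rewrite mulnBl (sqr_bin2 i).
    have : (i * i <= m * i)%N by rewrite leq_mul2r im orbT.
    by rewrite (sqr_bin2 i); lia.
  apply: (mulIf (expf_neq0 k X0)); apply: (mulIf (expf_neq0 (m - k) X0)).
  apply: (mulIf (expf_neq0 6 (P0 'C(k, 2)))); apply: (mulIf (expf_neq0 6 (P0 'C(m - k, 2)))).
  have h1 := HZ _ km; have := HZ _ (leq_subr k m); rewrite subKn // [(k * _)%N]mulnC -h1.
  rewrite !expr_div_n.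
  move: H (expf_neq0 k X0) (expf_neq0 (m - k) X0).
  move: (X ^+ k) (X ^+ (m - k)) ((_ * _) ^+ k) ((_ * _) ^+ (m - k)) => X1 X2 Z1 Z2.
  move: (p ^+ k) (p ^+ (m - k)) (p ^+ 'C(k, 2) ^+ 6) (p ^+ 'C(m - k, 2) ^+ 6).
  move=> p1 p2 c1 c2 H X10 X20 HH.
  transitivity (R2 * (X1 * c1) * (Z2 * p2 * c2)); first by field.
  by rewrite H HH; field.
have e i : (i <= m)%N -> (1 - p ^- m * p ^+ (2 * i)) * p ^+ (m - i) = p ^+ (m - i) - p ^+ i.
  move=> im; rewrite mulrBl mul1r; congr (_ - _).
  by rewrite -{1}(subnK im) exprD mul2n -addnn exprD; field; rewrite !P0.
apply: (mulIf (P0 k)); apply: (mulIf (P0 (m - k)%N)).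
have := e _ km; have := e _ (leq_subr k m); rewrite subKn // /wpterm.
move: E; move: (1 - _ * p ^+ (2 * (m - k))) (1 - _ * p ^+ (2 * k)).
move: (wpratio _ _ _ (m - k)) (wpratio _ _ _ k) => w1 w2 v1 v2 E e1 e2.
transitivity (v1 * p ^+ k * (w1 * p ^+ (m - k))); first by ring.
rewrite E e1; transitivity (- (v2 * p ^+ (m - k)) * (w2 * p ^+ k)); last by ring.
by rewrite e2; ring.
Qed.

Lemma sum_wpterm_eq0 p x m : (2%:R : F) != 0 -> p != 0 -> (forall r, x r != 0) ->
  (forall r, qpoch (p ^- m * p / x r) p m != 0) ->
  \sum_(k < m.+1) wpterm p (p ^- m) x k = 0.
Proof.
move=> n2 p0 x0 Y0; set S := LHS.
have : S = - S.
  rewrite {1}/S (reindex_inj rev_ord_inj) /= -sumrN; apply: eq_bigr => k _.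
  by rewrite subSS wpterm_reflect // -ltnS.
by move/eqP; rewrite -subr_eq0 opprK -mulr2n -mulr_natl mulf_eq0 (negPf n2) => /eqP.
Qed.
Local Notation o i := (@Ordinal 6 i isT).

Lemma big_ord6 (f : 'I_6 -> F) :
  \prod_r f r = f (o 0) * f (o 1) * f (o 2) * f (o 3) * f (o 4) * f (o 5).
Proof.
rewrite !big_ord_recr big_ord0 /= mul1r.
by do ![congr (_ * _)]; congr f; apply: val_inj.
Qed.

Lemma sum_wpterm_watson p A x m (b := x (o 0)) (c := x (o 1)) (d := x (o 2)) (e := x (o 3)) :
  x (o 4) = A -> x (o 5) = p ^- m -> p != 0 -> (forall r, x r != 0) ->
  (forall i, 1 - p ^+ i.+1 != 0) -> (forall i, 1 - A * p ^+ i.+1 != 0) ->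
  (forall r : 'I_6, (r < 4)%N -> forall i, 1 - A * p / x r * p ^+ i != 0) ->
  (\sum_(k < m.+1) wpterm p A x k)
    * (qpoch (A * p / d) p m * qpoch (A * p / e) p m)
  = qpoch A p m.+1 *
    \sum_(j < m.+1) qpoch (A * p / (b * c)) p j * qpoch (A * p / (d * e)) p (m - j)
      * (qpoch d p j * qpoch e p j * qpoch (p ^- m) p j)
      / (qpoch p p j * qpoch (A * p / b) p j * qpoch (A * p / c) p j)
      * ((- (A * p ^+ m.+1 / (d * e))) ^+ j / p ^+ 'C(j, 2)).
Proof.
move=> x4 x5 p0 x0 pn0 An0 xn0; have A0 : A != 0 by rewrite -x4.
rewrite -qWatson ?x0 //; try exact: xn0.
congr (_ * _); apply: eq_bigr => k _; rewrite /wpterm /wpratio.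
rewrite !big_ord6 x4 x5 -/b -/c -/d -/e.
have -> : A * p / A = p by rewrite mulrAC divff // mul1r.
have -> : A * p / p ^- m = A * p ^+ m.+1 by rewrite invrK exprS mulrA.
have -> : A ^+ 3 * p ^+ 2 / (b * c * d * e * A * p ^- m)
   = A ^+ 2 * p ^+ m.+2 / (b * c * d * e).
  have P0 : p ^+ m != 0 by rewrite expf_neq0.
  by rewrite !exprS; field; rewrite /b /c /d /e !x0 A0 P0.
rewrite !invfM ?invrK.
by ring.
Qed.
End WellPoised.

(** * Localization at a polynomial *)

(** Product rule: every term on the right contains a mixed difference or a product of two first
    differences, so second-order smallness passes to products. *)
Lemma mixed_diffM (R : comPzRingType) (x11 x10 x01 x00 y11 y10 y01 y00 : R) :
  x11 * y11 - x10 * y10 - x01 * y01 + x00 * y00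
  = x00 * (y11 - y10 - y01 + y00) + (x11 - x10 - x01 + x00) * y11
    + (x10 - x00) * (y11 - y10) + (x01 - x00) * (y11 - y01).
Proof. by ring. Qed.

Lemma subrACA (V : zmodType) (x y z t : V) : (x - y) - (z - t) = (x - z) - (y - t).
Proof. by rewrite !opprB addrACA [- y - z]addrC addrACA. Qed.

Lemma mixed_diffB (R : comPzRingType) (x11 x10 x01 x00 y11 y10 y01 y00 : R) :
  (x11 - y11) - (x10 - y10) - (x01 - y01) + (x00 - y00)
  = (x11 - x10 - x01 + x00) - (y11 - y10 - y01 + y00).
Proof. by ring. Qed.

Lemma geometric (R : comPzRingType) (x : R) n :
  (1 - x) * (\sum_(i < n) x ^+ i) = 1 - x ^+ n.
Proof.
rewrite -[X in X - x ^+ n](expr1n _ n) subrXX; congr (_ * _).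
by apply: eq_bigr => i _; rewrite expr1n mul1r.
Qed.

(** Brings [(Ap/x) p^l], for [A = t^z1], [x = u t^z2] and [p = t^d], to a constant times a power of
    [t], the form in which lower factors are tested for invertibility. *)
Lemma wp_lower (F : fieldType) (t u : F) (d : nat) (z1 z2 : int) l : t != 0 -> u != 0 ->
  t ^ z1 * t ^+ d / (u * t ^ z2) * (t ^+ d) ^+ l = u^-1 * t ^ (z1 - z2 + (d * l.+1)%:Z).
Proof.
move=> t0 u0; rewrite -exprM mulnS PoszD !expfzDr // -invr_expz -!exprnP.
by field; rewrite u0 expfz_neq0.
Qed.

Lemma eq_wpterm (F : fieldType) (t A : F) (x y : 'I_6 -> F) k :
  (forall r, x r = y r) -> wpterm t A x k = wpterm t A y k.
Proof.
move=> e; rewrite /wpterm /wpratio (eq_bigr _ (fun r _ => e r)); congr (_ * (_ * _)).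
by apply: eq_bigr => r _; rewrite e.
Qed.

(** * The sum of the theorem as a very-well-poised sum *)

Definition qsum (F : fieldType) (a b q : F) (d n : nat) : F :=
  \sum_(0 <= k < n)
     qint q ((2 * d * k)%:Z - 1)
     * (qpochs [:: a * q^-1; q^-1 / a; b * q^-1; q^-1 / b] (q ^+ d) k
        * qpoch q^-1 (q ^+ d) k ^+ 2)
     / (qpochs [:: a * q ^+ d; q ^+ d / a; b * q ^+ d; q ^+ d / b] (q ^+ d) k
        * qpoch (q ^+ d) (q ^+ d) k ^+ 2)
     * q ^+ ((2 * d + 3) * k).

(** With [A = 1/q] in base [q^d], the upper parameter [a/q] is paired with the lower one [q^d/a],
    and [1/(aq)] with [a q^d]; the argument is [q^(-3 + 2d + 6)]. *)
Lemma qsum_summand (F : fieldType) (a b q : F) (x : 'I_6 -> F) d k :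
  q != 0 -> a != 0 -> b != 0 ->
  x (@Ordinal 6 0 isT) = a * q^-1 -> x (@Ordinal 6 1 isT) = q^-1 / a ->
  x (@Ordinal 6 2 isT) = b * q^-1 -> x (@Ordinal 6 3 isT) = q^-1 / b ->
  x (@Ordinal 6 4 isT) = q^-1 -> x (@Ordinal 6 5 isT) = q^-1 ->
  qint q ((2 * d * k)%:Z - 1)
     * (qpochs [:: a * q^-1; q^-1 / a; b * q^-1; q^-1 / b] (q ^+ d) k
        * qpoch q^-1 (q ^+ d) k ^+ 2)
     / (qpochs [:: a * q ^+ d; q ^+ d / a; b * q ^+ d; q ^+ d / b] (q ^+ d) k
        * qpoch (q ^+ d) (q ^+ d) k ^+ 2)
     * q ^+ ((2 * d + 3) * k)
  = wpterm (q ^+ d) q^-1 x k / (1 - q).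
Proof.
move=> q0 a0 b0 x0 x1 x2 x3 x4 x5.
rewrite /wpterm /wpratio !big_ord6 x0 x1 x2 x3 x4 x5 /qpochs !big_cons !big_nil.
have -> : q^-1 * q ^+ d / (a * q^-1) = q ^+ d / a by field; rewrite ?oner_neq0 ?q0 ?a0.
have -> : q^-1 * q ^+ d / (b * q^-1) = q ^+ d / b by field; rewrite ?oner_neq0 ?q0 ?b0.
have -> : q^-1 * q ^+ d / (q^-1 / a) = a * q ^+ d by field; rewrite ?oner_neq0 ?q0 ?a0.
have -> : q^-1 * q ^+ d / (q^-1 / b) = b * q ^+ d by field; rewrite ?oner_neq0 ?q0 ?b0.
have -> : q^-1 * q ^+ d / q^-1 = q ^+ d by field; rewrite ?oner_neq0 ?q0.
have -> : q^-1 ^+ 3 * (q ^+ d) ^+ 2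
   / (a * q^-1 * (q^-1 / a) * (b * q^-1) * (q^-1 / b) * q^-1 * q^-1) = q ^+ (2 * d + 3).
  by rewrite exprD mulnC exprM; field; rewrite ?oner_neq0 ?q0 ?a0 ?b0.
have -> : qint q ((2 * d * k)%:Z - 1) = (1 - q^-1 * (q ^+ d) ^+ (2 * k)) / (1 - q).
  rewrite /qint expfzDr // -exprM -exprnP; congr ((1 - _) / _).
  by rewrite mulrC; congr (_ * _ ^+ _); lia.
rewrite -(exprM q (2 * d + 3) k) !expr2 !mulr1 !invfM; move: (q ^+ ((2 * d + 3) * k)) => z.
by ring.
Qed.

Section Localization.
Context {K F : fieldType} (iota : {rmorphism {poly K} -> F}).
Hypothesis iota_inj : injective iota.

Lemma iota_eq0 N : (iota N == 0) = (N == 0).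
Proof. by rewrite -(inj_eq iota_inj) rmorph0. Qed.

Implicit Types (P N D : {poly K}) (x y u : F).

(** Membership in [P^e] times the ring of fractions with denominator coprime to [P]; [e = 0] is
    membership in that ring. The fraction may be unreduced, which makes closure under sums and
    products direct. *)
Definition dvd_at P e x : Prop := exists N D,
  [/\ D != 0, coprimep D P & x = iota (P ^+ e * N) / iota D].

Definition unit_at P x : Prop := exists N D,
  [/\ N != 0, D != 0, coprimep N P, coprimep D P & x = iota N / iota D].

Lemma dvd_at_poly P N : dvd_at P 0 (iota N).
Proof. by exists N, 1; rewrite oner_neq0 coprime1p mul1r rmorph1 divr1. Qed.

Lemma dvd_at0 P e : dvd_at P e 0.
Proof. by exists 0, 1; rewrite oner_neq0 coprime1p mulr0 rmorph0 mul0r. Qed.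

Lemma dvd_at1 P : dvd_at P 0 1.
Proof. by rewrite -(rmorph1 iota); apply: dvd_at_poly. Qed.

Lemma dvd_atD P e x y : dvd_at P e x -> dvd_at P e y -> dvd_at P e (x + y).
Proof.
move=> [N [D [D0 cD ->]]] [N' [D' [D'0 cD' ->]]].
exists (N * D' + N' * D), (D * D'); split; first by rewrite mulf_neq0.
  by rewrite coprimepMl cD.
rewrite addf_div ?iota_eq0 // -!(rmorphM iota) -(rmorphD iota); congr (iota _ / _).
by rewrite mulrDr !mulrA.
Qed.

Lemma dvd_atN P e x : dvd_at P e x -> dvd_at P e (- x).
Proof.
move=> [N [D [D0 cD ->]]]; exists (- N), D; split=> //.
by rewrite mulrN rmorphN mulNr.
Qed.

Lemma dvd_atB P e x y : dvd_at P e x -> dvd_at P e y -> dvd_at P e (x - y).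
Proof. by move=> Hx Hy; apply: dvd_atD => //; apply: dvd_atN. Qed.

Lemma dvd_atM P e f x y : dvd_at P e x -> dvd_at P f y -> dvd_at P (e + f) (x * y).
Proof.
move=> [N [D [D0 cD ->]]] [N' [D' [D'0 cD' ->]]].
exists (N * N'), (D * D'); split; first by rewrite mulf_neq0.
  by rewrite coprimepMl cD.
rewrite mulf_div -!(rmorphM iota); congr (iota _ / _).
by rewrite exprD mulrACA.
Qed.

Lemma dvd_atMl P e x y : dvd_at P e x -> dvd_at P 0 y -> dvd_at P e (x * y).
Proof. by rewrite -{2}[e]addn0; apply: dvd_atM. Qed.

Lemma dvd_atMr P e x y : dvd_at P 0 x -> dvd_at P e y -> dvd_at P e (x * y).
Proof. by rewrite -{2}[e]add0n; apply: dvd_atM. Qed.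

Lemma dvd_atW P e f x : (f <= e)%N -> dvd_at P e x -> dvd_at P f x.
Proof.
move=> fe [N [D [D0 cD ->]]]; exists (P ^+ (e - f) * N), D; split=> //.
by rewrite mulrA -exprD subnKC.
Qed.

Lemma dvd_at_sum P e (I : Type) (r : seq I) (Q : pred I) (f : I -> _) :
  (forall i, Q i -> dvd_at P e (f i)) -> dvd_at P e (\sum_(i <- r | Q i) f i).
Proof. by move=> Hf; apply: big_ind => //; [apply: dvd_at0 | apply: dvd_atD]. Qed.

Lemma dvd_at_prod P (I : Type) (r : seq I) (Q : pred I) (f : I -> _) :
  (forall i, Q i -> dvd_at P 0 (f i)) -> dvd_at P 0 (\prod_(i <- r | Q i) f i).
Proof. by move=> Hf; apply: big_ind => //; [apply: dvd_at1 | move=> *; apply: dvd_atMl]. Qed.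

Lemma dvd_atX P x k : dvd_at P 0 x -> dvd_at P 0 (x ^+ k).
Proof.
by move=> Hx; elim: k => [|k IH]; [apply: dvd_at1 | rewrite exprS; apply: dvd_atMl].
Qed.

Lemma dvd_at_qpoch P x p k : dvd_at P 0 x -> dvd_at P 0 p -> dvd_at P 0 (qpoch x p k).
Proof.
move=> Hx Hp; apply: dvd_at_prod => i _; apply: dvd_atB; first exact: dvd_at1.
by apply: dvd_atMl => //; apply: dvd_atX.
Qed.

Lemma dvd_at_qpoch_factor P e x p k i : (i < k)%N -> dvd_at P 0 x -> dvd_at P 0 p ->
  dvd_at P e (1 - x * p ^+ i) -> dvd_at P e (qpoch x p k).
Proof.
move=> ik Hx Hp Hi; rewrite -(subnKC ik) qpochD qpochS.
apply: dvd_atMl; first apply: dvd_atMr => //.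
  exact: dvd_at_qpoch.
by apply: dvd_at_qpoch => //; apply: dvd_atMl => //; apply: dvd_atX.
Qed.

Lemma unit_at_dvd P x : unit_at P x -> dvd_at P 0 x.
Proof. by move=> [N [D [_ D0 _ cD ->]]]; exists N, D; rewrite mul1r. Qed.

Lemma unit_at_neq0 P x : unit_at P x -> x != 0.
Proof. by move=> [N [D [N0 D0 _ _ ->]]]; rewrite mulf_neq0 ?invr_neq0 ?iota_eq0. Qed.

Lemma unit_atV P x : unit_at P x -> unit_at P x^-1.
Proof. by move=> [N [D [N0 D0 cN cD ->]]]; exists D, N; split=> //; rewrite invf_div. Qed.

Lemma unit_atM P x y : unit_at P x -> unit_at P y -> unit_at P (x * y).
Proof.
move=> [N [D [N0 D0 cN cD ->]]] [N' [D' [N'0 D'0 cN' cD' ->]]].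
exists (N * N'), (D * D'); rewrite !mulf_neq0 ?coprimepMl ?cN ?cD //; split=> //.
by rewrite !rmorphM invfM mulrACA.
Qed.

Lemma unit_at_poly P N : N != 0 -> coprimep N P -> unit_at P (iota N).
Proof. by exists N, 1; rewrite oner_neq0 coprime1p rmorph1 divr1. Qed.

Lemma unit_at1 P : unit_at P 1.
Proof. by rewrite -(rmorph1 iota); apply: unit_at_poly; rewrite ?oner_neq0 ?coprime1p. Qed.

Lemma unit_at_prod P (I : Type) (r : seq I) (Q : pred I) (f : I -> _) :
  (forall i, Q i -> unit_at P (f i)) -> unit_at P (\prod_(i <- r | Q i) f i).
Proof. by move=> Hf; apply: big_ind => //; [apply: unit_at1 | apply: unit_atM]. Qed.

Lemma unit_atX P x k : unit_at P x -> unit_at P (x ^+ k).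
Proof.
by move=> Hx; elim: k => [|k IH]; [apply: unit_at1 | rewrite exprS; apply: unit_atM].
Qed.

Lemma unit_at_qpoch P x p k :
  (forall i, (i < k)%N -> unit_at P (1 - x * p ^+ i)) -> unit_at P (qpoch x p k).
Proof. by move=> H; apply: unit_at_prod => i _; apply: H. Qed.

Lemma dvd_at_unitM P e x u : unit_at P u -> dvd_at P e (x * u) -> dvd_at P e x.
Proof.
move=> Hu H; rewrite -[x](mulfK (unit_at_neq0 Hu)).
by apply: dvd_atMl => //; apply/unit_at_dvd/unit_atV.
Qed.

(** As [x * y] is congruent to the unit [u] modulo [P], the numerator of [x] is coprime to [P]; then
    [1 < size P] rules out [x = 0]. *)
Lemma unit_at_divisor P x y u : (1 < size P)%N -> dvd_at P 0 x -> dvd_at P 0 y ->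
  unit_at P u -> dvd_at P 1 (x * y - u) -> unit_at P x.
Proof.
move=> sP [N [D [D0 cD ->]]] [N' [D' [D'0 cD' ->]]] [U [V [U0 V0 cU cV ->]]].
move=> [M [E [E0 cE]]]; rewrite !mul1r expr1 => /eqP.
rewrite subr_eq => /eqP H.
have {}H : N * (N' * E * V) = D * D' * U * E + P * (M * V * D * D').
  apply/eqP; rewrite -(inj_eq iota_inj); apply/eqP; move: H.
  rewrite mulf_div addf_div ?iota_eq0 // => /eqP.
  rewrite -!(rmorphM iota, rmorphD iota) eqr_div ?iota_eq0 ?mulf_neq0 //.
  rewrite -!(rmorphM iota) (inj_eq iota_inj).
  by move/eqP=> H; apply: congr1; rewrite -mulrA mulrA H; ring.
have cN : coprimep N P.
  have : coprimep (N * (N' * E * V)) P.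
    rewrite H coprimep_sym addrC mulrC coprimep_addl_mul coprimep_sym.
    by rewrite !coprimepMl cD cD' cU cE.
  by rewrite coprimepMl => /andP[].
exists N, D; split=> //; apply: contraTneq cN => ->.
by rewrite coprime0p -size_poly_eq1 gtn_eqF.
Qed.
(** In [N D' = P^e N' D] with [N / D] reduced, [D] divides [D'], hence is coprime to [P]; and [P^e],
    being coprime to [D'], divides [N]. *)
Lemma dvd_at_reduced P e N D : D != 0 -> coprimep N D ->
  dvd_at P e (iota N / iota D) -> P ^+ e %| N /\ coprimep D P.
Proof.
move=> D0 cND [N' [D' [D'0 cD']]] /eqP.
rewrite eqr_div ?iota_eq0 // -!(rmorphM iota) (inj_eq iota_inj) => /eqP E.
have DD' : D %| D'.
  by rewrite -(Gauss_dvdpr _ (q := N)) 1?coprimep_sym // E dvdp_mull.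
split; last exact: coprimep_dvdr DD' cD'.
have cP : coprimep (P ^+ e) D' by rewrite coprimep_expl // coprimep_sym.
by rewrite -(Gauss_dvdpl _ cP) E -mulrA dvdp_mulr.
Qed.

Lemma dvd_at_fraction P e x : dvd_at P e x ->
  exists N D, [/\ D != 0, coprimep N D & x = iota N / iota D].
Proof.
move=> [N' [D [D0 _ ->]]]; set N := P ^+ e * N'; pose g := gcdp N D.
have g0 : g != 0 by rewrite gcdp_eq0 negb_and D0 orbT.
have eN : N = N %/ g * g by rewrite divpK // dvdp_gcdl.
have eD : D = D %/ g * g by rewrite divpK // dvdp_gcdr.
exists (N %/ g), (D %/ g); split.
- by apply: contraNneq D0 => Dg; rewrite eD Dg mul0r.
- by apply: coprimep_div_gcd; rewrite D0 orbT.
rewrite {1}eN {1}eD !rmorphM invfM mulrACA divff ?mulr1 //.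
by rewrite iota_eq0.
Qed.

(** * Two-parameter deformations and their mixed differences *)

Section Quad.
Variable P : {poly K}.
Implicit Types (g h : bool -> bool -> F).

(* Values at the four corners of a two-parameter deformation that is trivial
   mod P. *)
Definition quad g : Prop :=
  [/\ forall i j, dvd_at P 0 (g i j),
      forall i j i' j', dvd_at P 1 (g i j - g i' j')
    & dvd_at P 2 (g true true - g true false - g false true + g false false)].

Lemma quad_const x : dvd_at P 0 x -> quad (fun _ _ => x).
Proof.
split=> // [i j i' j'|]; first by rewrite subrr; apply: dvd_at0.
by rewrite subrr sub0r addNr; apply: dvd_at0.
Qed.

Lemma quad_left x0 x1 : dvd_at P 0 x0 -> dvd_at P 0 x1 -> dvd_at P 1 (x1 - x0) ->
  quad (fun i _ => if i then x1 else x0).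
Proof.
move=> H0 H1 H; split; first by case.
  by move=> [] _ [] _; rewrite ?subrr //;
    [exact: dvd_at0 | rewrite -opprB; exact: dvd_atN | exact: dvd_at0].
by rewrite subrr sub0r addNr; apply: dvd_at0.
Qed.

Lemma quad_right x0 x1 : dvd_at P 0 x0 -> dvd_at P 0 x1 -> dvd_at P 1 (x1 - x0) ->
  quad (fun _ j => if j then x1 else x0).
Proof.
move=> H0 H1 H; split; first by move=> _ [].
  by move=> _ [] _ []; rewrite ?subrr //;
    [exact: dvd_at0 | rewrite -opprB; exact: dvd_atN | exact: dvd_at0].
by rewrite addrAC subrK subrr; apply: dvd_at0.
Qed.

Lemma quadB g h : quad g -> quad h -> quad (fun i j => g i j - h i j).
Proof.
move=> [g0 g1 g2] [h0 h1 h2]; split=> [i j|i j i' j'|]; first exact: dvd_atB.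
  by rewrite subrACA; apply: dvd_atB.
by rewrite mixed_diffB; apply: dvd_atB.
Qed.

Lemma quadM g h : quad g -> quad h -> quad (fun i j => g i j * h i j).
Proof.
move=> [g0 g1 g2] [h0 h1 h2]; split=> [i j|i j i' j'|]; first exact: dvd_atMl.
  have -> : g i j * h i j - g i' j' * h i' j'
     = g i j * (h i j - h i' j') + (g i j - g i' j') * h i' j'.
    by rewrite mulrBr mulrBl addrA subrK.
  by apply: dvd_atD; [apply: dvd_atMr | apply: dvd_atMl].
rewrite mixed_diffM; apply: dvd_atD; last exact: (@dvd_atM _ 1 1).
apply: dvd_atD; last exact: (@dvd_atM _ 1 1).
by apply: dvd_atD; [apply: dvd_atMr | apply: dvd_atMl].
Qed.

(** The mixed difference of [g * g^-1 = 1] is zero, so the product rule expresses the unit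
    [g false false] times the mixed difference of [g^-1] by terms divisible by [P ^+ 2]. *)
Lemma quadV g : quad g -> (forall i j, unit_at P (g i j)) -> quad (fun i j => (g i j)^-1).
Proof.
move=> [g0 g1 g2] gu.
have g0' i j : dvd_at P 0 (g i j)^-1 by apply/unit_at_dvd/unit_atV.
have gn i j := unit_at_neq0 (gu i j).
have H1 i j i' j' : dvd_at P 1 ((g i j)^-1 - (g i' j')^-1).
  apply: (dvd_at_unitM (gu i j)); rewrite mulrBl mulVf //.
  apply: (dvd_at_unitM (gu i' j')); rewrite mulrBl mul1r mulrAC mulVf // mul1r.
  exact: g1.
split=> //; apply: (dvd_at_unitM (gu false false)); rewrite mulrC.
have := mixed_diffM (g true true) (g true false) (g false true) (g false false)
  (g true true)^-1 (g true false)^-1 (g false true)^-1 (g false false)^-1.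
rewrite !divff ?gn // subrr sub0r addNr -addrA -addrA => /esym/eqP.
rewrite addr_eq0 => /eqP ->.
apply: dvd_atN; apply: dvd_atD; first exact: dvd_atMl.
by apply: dvd_atD; apply: (@dvd_atM _ 1 1).
Qed.

Lemma quadX g k : quad g -> quad (fun i j => g i j ^+ k).
Proof.
move=> gq; elim: k => [|k IH]; first exact/quad_const/dvd_at1.
have := quadM gq IH; rewrite /quad => -[h0 h1 h2].
by split=> *; rewrite ?exprS; auto.
Qed.

Lemma quad_ext g h : (forall i j, g i j = h i j) -> quad h -> quad g.
Proof.
by move=> e [h0 h1 h2]; split=> [i j|i j i' j'|]; rewrite !e.
Qed.

Lemma quad_prod (I : Type) (r : seq I) (g : I -> bool -> bool -> _) :
  (forall s, quad (g s)) -> quad (fun i j => \prod_(s <- r) g s i j).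
Proof.
move=> gq; elim: r => [|s r IH].
  by apply: quad_ext (quad_const (dvd_at1 P)) => i j; rewrite big_nil.
by apply: quad_ext (quadM (gq s) IH) => i j; rewrite big_cons.
Qed.

Lemma quadD g h : quad g -> quad h -> quad (fun i j => g i j + h i j).
Proof.
move=> gq hq; have q0 := quad_const (dvd_at0 P 0).
by apply: quad_ext (quadB gq (quadB q0 hq)) => i j; rewrite sub0r opprK.
Qed.

Lemma quad_sum (I : Type) (r : seq I) (g : I -> bool -> bool -> _) :
  (forall s, quad (g s)) -> quad (fun i j => \sum_(s <- r) g s i j).
Proof.
move=> gq; elim: r => [|s r IH].
  by apply: quad_ext (quad_const (dvd_at0 P 0)) => i j; rewrite big_nil.
by apply: quad_ext (quadD (gq s) IH) => i j; rewrite big_cons.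
Qed.

Lemma quad_qpoch g p k : dvd_at P 0 p -> quad g -> quad (fun i j => qpoch (g i j) p k).
Proof.
move=> Hp gq; apply: quad_prod => s; apply: quadB; first exact/quad_const/dvd_at1.
by apply: quadM => //; apply/quad_const/dvd_atX.
Qed.

Lemma quad_wpterm p A (x : 'I_6 -> bool -> bool -> F) k :
  dvd_at P 0 p -> quad A -> (forall r, quad (x r)) ->
  (forall r i j, unit_at P (x r i j)) ->
  (forall r i j, unit_at P (qpoch (A i j * p / x r i j) p k)) ->
  quad (fun i j => wpterm p (A i j) (fun r => x r i j) k).
Proof.
move=> Hp Aq xq xu du; have Hpk e := quad_const (dvd_atX e Hp).
have q1 := quad_const (dvd_at1 P).
apply: quadM; first by apply: quadB => //; apply: quadM.
apply: quadM.
  apply: quad_prod => r; apply: quadM; first exact: quad_qpoch.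
  apply: quadV => //; apply: quad_qpoch => //; apply: quadM; last exact: quadV.
  by apply: quadM => //; apply: quad_const.
apply: quadX; apply: quadM; first by apply: quadM => //; apply: quadX.
apply: quadV; first exact: quad_prod.
by move=> i j; apply: unit_at_prod.
Qed.
End Quad.

(** * Cyclotomic polynomials in characteristic zero and units at Phi_m *)

Section Cyclotomic.
Hypothesis char0 : forall n, (0 < n)%N -> n%:R != 0 :> K.
Local Notation Phi := (cyclop K).
Local Notation q := (iota ('X : {poly K})).

Lemma prod_cyclop n : (0 < n)%N -> \prod_(m <- divisors n) Phi m = 'X^n - 1.
Proof.
move=> n0; rewrite -(rmorph_prod (map_poly (intmul (1 : K)))) prod_Cyclotomic //.
by rewrite rmorphB /= map_polyXn rmorph1.
Qed.

Lemma size_cyclop m : size (Phi m) = (totient m).+1.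
Proof.
rewrite /cyclop size_map_poly_id0 ?size_Cyclotomic //.
by rewrite (monicP (Cyclotomic_monic m)) oner_neq0.
Qed.

Lemma size_cyclop_gt1 m : (0 < m)%N -> (1 < size (Phi m))%N.
Proof. by move=> m0; rewrite size_cyclop ltnS totient_gt0. Qed.

Lemma cyclop_dvd m n : (0 < n)%N -> (m %| n)%N -> Phi m %| 'X^n - 1.
Proof.
move=> n0 mn; rewrite -prod_cyclop // (big_rem m) -?dvdn_divisors //=.
exact: dvdp_mulr.
Qed.

(** In characteristic zero [X^n - 1] is separable, so distinct factors of its cyclotomic product are
    coprime. *)
Lemma coprimep_cyclop n l m : (0 < n)%N -> (l %| n)%N -> (m %| n)%N -> l != m ->
  coprimep (Phi l) (Phi m).
Proof.
move=> n0 ln mn lm.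
have := @separable_Xn_sub_1 K n (char0 n0).
rewrite -prod_cyclop // (big_rem l) -?dvdn_divisors //= (big_rem m) /=.
  by rewrite !separable_mul coprimepMr => /and3P[_ _ /andP[]].
by rewrite mem_rem_uniq ?divisors_uniq // inE eq_sym lm -dvdn_divisors.
Qed.

Lemma coprimep_X_cyclop m : (0 < m)%N -> coprimep 'X (Phi m).
Proof.
move=> m0; apply: coprimep_dvdl (cyclop_dvd m0 (dvdnn m)) _.
rewrite coprimep_sym coprimepX rootE !hornerE expr0n eqn0Ngt m0 /= sub0r.
by rewrite oppr_eq0 oner_neq0.
Qed.

Section AtPhi.
Variable m : nat.
Hypothesis m1 : (1 < m)%N.
Let m0 : (0 < m)%N. Proof. exact: ltnW. Qed.
Local Notation P := (Phi m).

Lemma q_neq0 : q != 0. Proof. by rewrite iota_eq0 polyX_eq0. Qed.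

Lemma unit_at_q : unit_at P q.
Proof. by apply: unit_at_poly; rewrite ?polyX_eq0 ?coprimep_X_cyclop. Qed.

Lemma unit_at_qz (z : int) : unit_at P (q ^ z).
Proof. by case: z => k; [|apply: unit_atV]; apply: unit_atX; apply: unit_at_q. Qed.

Lemma unit_at_const (c : K) : c != 0 -> unit_at P (iota c%:P).
Proof.
move=> c0; apply: unit_at_poly; first by rewrite polyC_eq0.
by rewrite -alg_polyC coprimepZl ?coprime1p.
Qed.

Lemma dvd_at_qz (z : int) : dvd_at P 0 (q ^ z).
Proof. exact/unit_at_dvd/unit_at_qz. Qed.

Lemma dvd_at_1subqz (z : int) : (m%:Z %| z)%Z -> dvd_at P 1 (1 - q ^ z).
Proof.
move=> mz.
have H k : (m %| k)%N -> dvd_at P 1 (1 - q ^+ k).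
  move=> mk; case: (posnP k) => [->|k0]; first by rewrite subrr; apply: dvd_at0.
  rewrite -opprB; apply: dvd_atN; have /dvdpP[R E] := cyclop_dvd k0 mk.
  exists R, 1; rewrite oner_neq0 coprime1p; split=> //.
  by rewrite expr1 [P * R]mulrC -E rmorph1 divr1 rmorphB rmorphXn rmorph1.
case: z mz => k mk; first exact: H.
have -> : 1 - q ^ Negz k = - (1 - q ^+ k.+1) * q ^ Negz k.
  by rewrite opprB mulrBl mul1r divff // expf_neq0 // q_neq0.
by apply: dvd_atMl (dvd_at_qz _); apply/dvd_atN/H.
Qed.

(** For a proper divisor [g] of [m], [1 - q^g] is up to sign the product of the [Phi_l] with
    [l | g], all coprime to [Phi_m]. For general [k] take [g = gcd(k, m)]: by Bezout
    [k u = v m + g], so a multiple of [1 - q^k] is congruent to [1 - q^g] modulo [Phi_m]. *)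
Lemma unit_at_1subqz (z : int) : ~~ (m%:Z %| z)%Z -> unit_at P (1 - q ^ z).
Proof.
have Hg g : (0 < g)%N -> (g %| m)%N -> g != m -> unit_at P (1 - q ^+ g).
  move=> g0 gm gnm; rewrite -(rmorphXn iota) -(rmorph1 iota) -(rmorphB iota) -opprB -scaleN1r.
  have n1 : -1 != 0 :> K by rewrite oppr_eq0 oner_neq0.
  apply: unit_at_poly; rewrite ?coprimepZl // ?scaler_eq0 ?(negPf n1) /=.
    by rewrite -size_poly_eq0 size_XnsubC.
  rewrite -prod_cyclop // big_seq.
  apply: (big_ind (fun R : {poly K} => is_true (coprimep R P))).
  - exact: coprime1p.
  - by move=> x y cx cy; rewrite coprimepMl cx.
  move=> l; rewrite -dvdn_divisors // => lg.
  apply: (@coprimep_cyclop m) => //; first exact: dvdn_trans gm.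
  apply: contraNneq gnm => lm; rewrite eqn_dvd gm -lm.
  by rewrite lm in lg *.
have H k : ~~ (m %| k)%N -> unit_at P (1 - q ^+ k).
  move=> mk; have k0 : (0 < k)%N by case: k mk => //; rewrite dvdn0.
  have [u v E _] := egcdnP m k0.
  have gm : gcdn k m != m by apply: contraNneq mk => <-; apply: dvdn_gcdl.
  apply: (@unit_at_divisor _ _ (\sum_(i < u) (q ^+ k) ^+ i) (1 - q ^+ gcdn k m)).
  - exact: size_cyclop_gt1.
  - by apply: dvd_atB; [exact: dvd_at1 | exact/unit_at_dvd/unit_atX/unit_at_q].
  - by apply: dvd_at_sum => i _; do 2!apply: dvd_atX; apply/unit_at_dvd/unit_at_q.
  - by apply: Hg; rewrite ?gcdn_gt0 ?k0 ?dvdn_gcdr.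
  rewrite geometric -exprM mulnC E.
  have -> : 1 - q ^+ (v * m + gcdn k m) - (1 - q ^+ gcdn k m)
     = (1 - q ^+ (v * m)) * q ^+ gcdn k m.
    by rewrite subrACA subrr sub0r opprB mulrBl mul1r -exprD.
  apply: dvd_atMl; last exact/unit_at_dvd/unit_atX/unit_at_q.
  by apply: (@dvd_at_1subqz (v * m)%N); rewrite dvdzE /= dvdn_mull.
case: z => k mk; first exact: H.
have -> : 1 - q ^ Negz k = (- q ^ Negz k) * (1 - q ^+ k.+1).
  by rewrite mulrBr mulr1 mulNr opprK mulVf ?expf_neq0 ?q_neq0 // addrC.
apply: unit_atM; last exact: H.
by rewrite -mulN1r -(rmorph1 iota) -(rmorphN iota) -polyCN;
  apply: unit_atM (unit_at_const _) (unit_at_qz _); rewrite oppr_eq0 oner_neq0.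
Qed.

(** With [x = c q^z], the multiple [1 - x^m] of [1 - x] is congruent modulo [Phi_m] to the nonzero
    constant [1 - c^m]. *)
Lemma unit_at_1subcqz (c : K) (z : int) : c ^+ m != 1 -> unit_at P (1 - iota c%:P * q ^ z).
Proof.
move=> cm; set x := _ * _.
have Hx : dvd_at P 0 x by apply: dvd_atMl (dvd_at_qz _); apply: dvd_at_poly.
apply: (@unit_at_divisor _ _ (\sum_(i < m) x ^+ i) (iota (1 - c ^+ m)%:P)).
- exact: size_cyclop_gt1.
- by apply: dvd_atB => //; exact: dvd_at1.
- by apply: dvd_at_sum => i _; apply: dvd_atX.
- by apply: unit_at_const; rewrite subr_eq0 eq_sym.
rewrite geometric polyCB rmorphB rmorph1 /x exprMn polyC_exp rmorphXn.
set C := iota c%:P ^+ m.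
have -> : 1 - C * (q ^ z) ^+ m - (1 - C) = C * (1 - q ^ (z * m%:Z)).
  by rewrite subrACA subrr sub0r opprB mulrBr mulr1 -exprz_exp.
apply: dvd_atMr; first by apply: dvd_atX; apply: dvd_at_poly.
by apply: dvd_at_1subqz; rewrite dvdz_mull.
Qed.
End AtPhi.

(** * The very-well-poised sum with parameters c_r / q in base q^d *)

Variable c : 'I_6 -> K.
Hypothesis c_neq0 : forall r, c r != 0.
Hypothesis c_generic : forall (r : 'I_6) m, (0 < m)%N -> (r < 4)%N -> c r ^+ m != 1.
Hypothesis c_one : forall r : 'I_6, (4 <= r)%N -> c r = 1.
Variable d : nat.
Local Notation p := (q ^+ d).
Local Notation C r := (iota (c r)%:P).
Local Notation X := (fun r => C r * q^-1).
Let q0 : q != 0 := q_neq0.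
Let p0 : p != 0. Proof. by rewrite expf_neq0 ?q0. Qed.

Lemma C_neq0 r : C r != 0. Proof. by rewrite iota_eq0 polyC_eq0. Qed.

Lemma CV r : (C r)^-1 = iota (c r)^-1%:P.
Proof.
by apply: (mulIf (C_neq0 r)); rewrite mulVf ?C_neq0 //
  -(rmorphM iota) -polyCM mulVf ?c_neq0 // rmorph1.
Qed.

Section AtPhi.
Variable m : nat.
Hypothesis m1 : (1 < m)%N.
Hypothesis co_md : coprime m d.
Local Notation P := (cyclop K m).
Let m0 : (0 < m)%N. Proof. exact: ltnW. Qed.

Lemma ndvd_d l (z : int) : (0 < l < m)%N -> (m%:Z %| z)%Z ->
  ~~ (m%:Z %| z + (d * l)%:Z)%Z.
Proof.
move=> /andP[l0 lm] mz; rewrite rpredDl // dvdzE /= Gauss_dvdr //.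
by apply: contraTN lm => /(dvdn_leq l0); rewrite -leqNgt.
Qed.

(** The factor is [1 - c_r^-1 q^z] with [z] congruent to [d(l+1)] modulo [m]. For [r < 4] the
    constant is generic; otherwise it is 1, and [m] does not divide [z] because [0 < l + 1 < m] and
    [m] is coprime to [d]. *)
Lemma unit_at_lower r l (z1 z2 : int) : (l.+1 < m)%N ->
  (m%:Z %| z1 - z2)%Z ->
  unit_at P (1 - q ^ z1 * p / (C r * q ^ z2) * p ^+ l).
Proof.
move=> lm mz; rewrite wp_lower ?C_neq0 // CV.
case: (ltnP r 4) => r4.
  by apply: unit_at_1subcqz => //; rewrite exprVn invr_eq1 c_generic.
rewrite c_one // invr1 rmorph1 mul1r; apply: unit_at_1subqz => //.
exact: ndvd_d.
Qed.

Lemma unit_at_lower_generic (r : 'I_6) l (z1 z2 : int) : (r < 4)%N ->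
  unit_at P (1 - q ^ z1 * p / (C r * q ^ z2) * p ^+ l).
Proof.
move=> r4; rewrite wp_lower ?C_neq0 // CV.
by apply: unit_at_1subcqz => //; rewrite exprVn invr_eq1 c_generic.
Qed.

Lemma unit_at_Cq r (z : int) : unit_at P (C r * q ^ z).
Proof. by apply: unit_atM (unit_at_qz m1 z); apply: unit_at_const. Qed.

Lemma unit_at_p k : unit_at P (p ^+ k).
Proof. by do 2!apply: unit_atX; apply: unit_at_q. Qed.

Lemma quad_wp (al : bool -> bool -> int) (be : 'I_6 -> bool -> bool -> int) k :
  (k < m)%N -> quad P (fun i j => q ^ al i j) ->
  (forall r, quad P (fun i j => q ^ be r i j)) ->
  (forall r i j, (m%:Z %| al i j - be r i j)%Z) ->
  quad P (fun i j => wpterm p (q ^ al i j) (fun r => C r * q ^ be r i j) k).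
Proof.
move=> km qa qb dab; apply: (@quad_wpterm _ _ _ (fun r i j => C r * q ^ be r i j)).
- by have := unit_at_dvd (unit_at_p 1); rewrite expr1.
- exact: qa.
- by move=> r; apply: quadM (qb r); apply/quad_const/dvd_at_poly.
- by move=> r i j; apply: unit_at_Cq.
move=> r i j; apply: unit_at_qpoch => l lk; apply: unit_at_lower => //.
exact: leq_ltn_trans km.
Qed.

Lemma exists_dinv : exists2 M, (M < m)%N & (m%:Z %| (d * M)%:Z - 1)%Z.
Proof.
have d0 : (0 < d)%N.
  move: co_md; case: (d) => //.
  by rewrite /coprime gcdn0 => /eqP m_1; move: m1; rewrite m_1.
have [u v E _] := egcdnP m d0; exists (u %% m)%N; first by rewrite ltn_mod.
rewrite gcdnC (eqP co_md) in E.
have := divn_eq u m; set k := (u %/ m)%N; set M := (u %% m)%N => eu.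
(* From [u d = v m + 1] and [u = k m + M], the quotient of [d M - 1] by [m] is [v - d k]. *)
apply/dvdzP; exists (v%:Z - (d * k)%:Z); nia.
Qed.

Lemma dvd_at_diffqz (z1 z2 : int) : (m%:Z %| z1 - z2)%Z -> dvd_at P 1 (q ^ z1 - q ^ z2).
Proof.
move=> mz; have -> : q ^ z1 - q ^ z2 = - ((1 - q ^ (z1 - z2)) * q ^ z2).
  by rewrite mulrBl mul1r opprB -expfzDr // subrK.
by apply/dvd_atN/dvd_atMl; [exact: dvd_at_1subqz | exact: dvd_at_qz].
Qed.

Lemma ratio_at0 r k : (k < m)%N ->
  dvd_at P 0 (qpoch (C r * q^-1) p k / qpoch (q^-1 * p / (C r * q^-1)) p k).
Proof.
move=> km; apply: dvd_atMl.
  by apply: dvd_at_qpoch; apply: unit_at_dvd;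
    [exact: (unit_at_Cq r (-1)) | have := unit_at_p 1; rewrite expr1].
apply/unit_at_dvd/unit_atV/unit_at_qpoch => l lk.
apply: (@unit_at_lower r l (-1) (-1)); first exact: leq_ltn_trans km.
by rewrite subrr dvdz0.
Qed.

Lemma unit_at_z k : unit_at P ((q^-1 ^+ 3 * p ^+ 2 / \prod_r X r) ^+ k).
Proof.
apply: unit_atX; apply: unit_atM; last first.
  by apply/unit_atV/unit_at_prod => r _; exact: (unit_at_Cq r (-1)).
by apply: unit_atM (unit_at_p 2); apply/unit_atX; exact: (unit_at_qz m1 (-1)).
Qed.

Lemma qM1 M : q^-1 * p ^+ M = q ^ ((d * M)%:Z - 1).
Proof. by rewrite addrC expfzDr // -exprM. Qed.

(** The factor of index [M] in [(1/q; p)_k] is [1 - q^(dM-1)], divisible by [Phi_m]. It occurs for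
    both [r = 4] and [r = 5], whence the exponent 2; the lower factors are units as [k < m]. *)
Lemma wp_tail M k : (m%:Z %| (d * M)%:Z - 1)%Z -> (M < k < m)%N ->
  dvd_at P 2 (wpterm p q^-1 X k).
Proof.
move=> dM /andP[Mk km]; have Hq := dvd_at_qz m1 (-1).
have Hp : dvd_at P 0 p by have := unit_at_dvd (unit_at_p 1); rewrite expr1.
apply: dvd_atMr.
  by apply: dvd_atB; [exact: dvd_at1 | apply: dvd_atMl => //; exact: dvd_atX].
apply: dvd_atMl; last exact/unit_at_dvd/unit_at_z.
have H (r : 'I_6) : (4 <= r)%N ->
  dvd_at P 1 (qpoch (C r * q^-1) p k / qpoch (q^-1 * p / (C r * q^-1)) p k).
  move=> r4; apply: dvd_atMl; last first.
    apply/unit_at_dvd/unit_atV/unit_at_qpoch => l lk.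
    apply: (@unit_at_lower r l (-1) (-1)); first exact: leq_ltn_trans km.
    by rewrite subrr dvdz0.
  apply: (dvd_at_qpoch_factor Mk) => //; first exact: (unit_at_dvd (unit_at_Cq r (-1))).
  rewrite c_one // rmorph1 mul1r qM1; exact: dvd_at_1subqz.
rewrite !big_ord_recr /=; apply: (@dvd_atM _ 1 1); last exact: H.
apply: dvd_atMr; last exact: H.
rewrite big_ord0; do 4![apply: dvd_atMl; last exact: ratio_at0]; exact: dvd_at1.
Qed.

(** * Deformation of the two parameters 1/q *)

Section Deformation.
Variable M : nat.
Hypothesis ltMm : (M < m)%N.
Hypothesis dM : (m%:Z %| (d * M)%:Z - 1)%Z.

Let al (i : bool) : int := if i then -1 else - (d * M)%:Z.
Let be (r : 'I_6) (i j : bool) : int :=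
  if (r < 4)%N then -1 else if r == 4 :> nat then al i else al j.

(* The parameter A = 1/q and one numerator parameter 1/q are deformed
   independently to q^(-dM), which is congruent to 1/q. *)
Definition wpdeform i j : F :=
  \sum_(0 <= k < M.+1) wpterm p (q ^ al i) (fun r => C r * q ^ be r i j) k.

Let al_mod i : (m%:Z %| al i + 1)%Z.
Proof. by case: i; rewrite /= ?addNr ?dvdz0 // addrC -opprB rpredN. Qed.

Let be_mod r i j : (m%:Z %| be r i j + 1)%Z.
Proof.
rewrite /be; case: ifP => _; first by rewrite addNr dvdz0.
by case: ifP => _; exact: al_mod.
Qed.

(** All exponents [al i] and [be r i j] are congruent to -1 modulo [m], so the deformation is
    trivial modulo [Phi_m] and the lower factors stay units for [k <= M < m]. *)
Lemma quad_wpdeform : quad P wpdeform.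
Proof.
have dal : dvd_at P 1 (q ^ al true - q ^ al false).
  apply: dvd_at_diffqz; have := al_mod false; rewrite /= addrC => H.
  by rewrite opprK addrC -opprB rpredN.
have ql : quad P (fun i _ => q ^ al i).
  by apply: quad_ext (quad_left (dvd_at_qz m1 _) (dvd_at_qz m1 _) dal) => -[].
have qr : quad P (fun _ j => q ^ al j).
  by apply: quad_ext (quad_right (dvd_at_qz m1 _) (dvd_at_qz m1 _) dal) => i [].
rewrite /wpdeform; apply: quad_ext => [i j|]; first by rewrite big_mkord.
apply: (@quad_sum _ 'I_M.+1 _ (fun k i j =>
  wpterm p (q ^ al i) (fun r => C r * q ^ be r i j) (nat_of_ord k))).
move=> k; apply: (@quad_wp (fun i _ => al i)) => //.
- exact: leq_trans (ltn_ord k) ltMm.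
- move=> r; rewrite /be; case: (r < 4)%N; first exact/quad_const/dvd_at_qz.
  by case: (r == 4 :> nat).
- move=> r i j; have -> : al i - be r i j = (al i + 1) - (be r i j + 1).
    by rewrite opprD addrACA subrr addr0.
  exact: rpredB.
Qed.

(** With [i = false], [A] equals [p^-M] for either value of [j], and the reflection [k -> M - k]
    makes the sum vanish. *)
Lemma wpdeform_false j : wpdeform false j = 0.
Proof.
rewrite /wpdeform big_mkord.
have -> : q ^ al false = p ^- M by rewrite /= -exprnN exprM.
apply: sum_wpterm_eq0.
- have := char0 (isT : (0 < 2)%N).
  by rewrite -!(rmorph_nat iota, rmorph_nat polyC) iota_eq0 polyC_eq0.
- exact: p0.
- by move=> r; apply: mulf_neq0; [exact: C_neq0 | exact/expfz_neq0/q0].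
move=> r; have -> : p ^- M = q ^ al false by rewrite /= -exprnN exprM.
apply/(@unit_at_neq0 P)/unit_at_qpoch => l lM; apply: unit_at_lower => //.
  exact: leq_ltn_trans ltMm.
have -> : al false - be r false j = (al false + 1) - (be r false j + 1).
  by rewrite opprD addrACA subrr addr0.
exact: rpredB.
Qed.

Lemma wpdeform_true : wpdeform true true = \sum_(0 <= k < M.+1) wpterm p q^-1 X k.
Proof.
apply: eq_bigr => k _; apply: eq_wpterm => r.
have -> // : be r true true = -1 by rewrite /be /=; case: ifP => // _; case: ifP.
Qed.

(** The mixed difference reduces to these two corners, because both corners with [i = false]
    vanish. *)
Lemma wpsum_head2 : dvd_at P 2
  ((\sum_(0 <= k < M.+1) wpterm p q^-1 X k) - wpdeform true false).
Proof.
have [_ _] := quad_wpdeform.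
by rewrite !wpdeform_false wpdeform_true subr0 addr0.
Qed.

Lemma wpsum_split2 : dvd_at P 2 ((\sum_(0 <= k < m) wpterm p q^-1 X k)
   - \sum_(0 <= k < M.+1) wpterm p q^-1 X k).
Proof.
rewrite (@big_cat_nat _ _ _ M.+1) //= addrAC subrr add0r big_seq.
apply: dvd_at_sum => k; rewrite mem_index_iota => Mkm; exact: wp_tail dM Mkm.
Qed.

Lemma wpsum_at1_aux : dvd_at P 1 (\sum_(0 <= k < m) wpterm p q^-1 X k).
Proof.
rewrite -[X in dvd_at P 1 X](subrK (\sum_(0 <= k < M.+1)
  wpterm p q^-1 (fun r => C r * q^-1) k)).
apply: dvd_atD; first exact: dvd_atW wpsum_split2.
(* Modulo [Phi_m] the corner [true true] agrees with [false false], where the sum is zero. *)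
have [_ H _] := quad_wpdeform; have := H true true false false.
by rewrite wpdeform_false wpdeform_true subr0.
Qed.
End Deformation.

(** * Blocks of m consecutive terms *)

Lemma wpsum_block_at1 : dvd_at P 1 (\sum_(0 <= k < m) wpterm p q^-1 X k).
Proof. by have [M ltMm dM] := exists_dinv; apply: wpsum_at1_aux dM. Qed.

(** Cancelling [1 - q^m] leaves two sums of powers of [q^m]; the lower one is congruent modulo
    [Phi_m] to its number of terms, a nonzero constant in characteristic zero. *)
Lemma quotient_at0 (u v : nat) : (m %| u)%N -> (m %| v)%N -> (0 < v)%N ->
  dvd_at P 0 ((1 - q ^+ u) / (1 - q ^+ v)).
Proof.
move=> /dvdnP[u' ->] /dvdnP[v' ->] v0.
have v'0 : (0 < v')%N by move: v0; rewrite muln_gt0 => /andP[].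
rewrite ![(_ * m)%N]mulnC !exprM -(geometric _ u') -(geometric _ v').
have Q0 k : dvd_at P 0 ((q ^+ m) ^+ k) by do 2!apply: dvd_atX; exact/unit_at_dvd/unit_at_q.
have Qm0 : 1 - q ^+ m != 0.
  rewrite -(rmorphXn iota) -(rmorph1 iota) -(rmorphB iota) iota_eq0 -oppr_eq0 opprB.
  by rewrite -size_poly_eq0 size_XnsubC.
rewrite invfM mulrACA. rewrite divff // mul1r; apply: dvd_atMl; first exact: dvd_at_sum.
apply/unit_at_dvd/unit_atV.
apply: (@unit_at_divisor _ _ 1 (iota (v'%:R)%:P)).
- exact: size_cyclop_gt1.
- exact: dvd_at_sum.
- exact: dvd_at1.
- by apply: unit_at_const; exact: char0.
rewrite mulr1 rmorph_nat rmorph_nat -[v' in v'%:R]card_ord -sumr_const -sumrB.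
apply: dvd_at_sum => k _; rewrite -opprB -exprM; apply: dvd_atN.
by apply: (@dvd_at_1subqz _ m1 (m * k)%N); rewrite dvdzE /= dvdn_mulr.
Qed.

(** Used with [L] a multiple of [m], when the shifted exponents are unchanged modulo [m]. *)
Lemma wpterm_shift L k : wpterm p q^-1 X (L + k)
  = wpratio p q^-1 X L * wpterm p (q ^ (-1 + (d * (2 * L))%:Z))
      (fun r => C r * q ^ (-1 + (d * L)%:Z)) k.
Proof.
rewrite {1}/wpterm wpratioD //; last by move=> r; rewrite mulf_neq0 ?C_neq0 ?invr_neq0.
rewrite mulrCA; congr (_ * _).
have -> : q ^ (-1 + (d * (2 * L))%:Z) = q^-1 * p ^+ (2 * L).
  by rewrite expfzDr // -exprM.
rewrite mulnDr exprD mulrA; apply: eq_wpterm => r.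
by rewrite -mulrA; congr (_ * _); rewrite expfzDr // -exprM.
Qed.

(** For [r < 4] every lower factor is a unit. For [r = 4, 5] exactly the last lower factor,
    [1 - q^(d(l+1)m)], is divisible by [Phi_m]; it is offset, through [quotient_at0], by the upper
    factor of index [M], which is [1 - q^(dM-1+dlm)]. *)
Lemma wpratio_block_at0 l : dvd_at P 0
  (wpratio p (q^-1 * p ^+ (2 * (l * m))) (fun r => C r * q^-1 * p ^+ (l * m)) m).
Proof.
have Hp : dvd_at P 0 p by have := unit_at_dvd (unit_at_p 1); rewrite expr1.
have HC r : unit_at P (C r * q^-1 * p ^+ (l * m)).
  by apply: unit_atM; [exact: (unit_at_Cq r (-1)) | exact: unit_at_p].
have HA : unit_at P (q^-1 * p ^+ (2 * (l * m))).
  by apply: unit_atM; [exact: (unit_at_qz m1 (-1)) | exact: unit_at_p].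
apply: dvd_atMl; last first.
  apply/unit_at_dvd/unit_atX/unit_atM; last by apply/unit_atV/unit_at_prod.
  by apply: unit_atM; [exact: unit_atX | exact: unit_at_p].
have eA : q^-1 * p ^+ (2 * (l * m)) = q ^ (-1 + (d * (2 * (l * m)))%:Z).
  by rewrite expfzDr // -exprM.
have eX r : C r * q^-1 * p ^+ (l * m) = C r * q ^ (-1 + (d * (l * m))%:Z).
  by rewrite -mulrA expfzDr // -exprM.
apply: dvd_at_prod => r _; case: (ltnP r 4) => r4.
  apply: dvd_atMl; first exact: dvd_at_qpoch (unit_at_dvd (HC r)) Hp.
  apply/unit_at_dvd/unit_atV/unit_at_qpoch => i im.
  by rewrite eA eX; exact: unit_at_lower_generic.
have [M ltMm dM] := exists_dinv.
have dM0 : (0 < d * M)%N.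
  by rewrite lt0n; apply: contraTneq dM => ->; rewrite sub0r rpredN dvdzE /= dvdn1 gtn_eqF.
have -> : qpoch (C r * q^-1 * p ^+ (l * m)) p m = (1 - q ^+ (d * M - 1 + d * (l * m)))
   * (qpoch (C r * q^-1 * p ^+ (l * m)) p M
      * qpoch (C r * q^-1 * p ^+ (l * m) * p ^+ M.+1) p (m - M.+1)).
  have qpochE Y : qpoch Y p m = (1 - Y * p ^+ M)
      * (qpoch Y p M * qpoch (Y * p ^+ M.+1) p (m - M.+1)).
    by rewrite -{1}(subnKC ltMm) qpochD qpochS -mulrA mulrCA.
  rewrite qpochE; congr (_ * _).
  congr (1 - _); rewrite c_one // rmorph1 mul1r -!exprM mulrAC.
  apply: (mulfI q0); rewrite -mulrA mulVKf // -exprD -exprS.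
  by congr (_ ^+ _); lia.
have -> : qpoch (q^-1 * p ^+ (2 * (l * m)) * p / (C r * q^-1 * p ^+ (l * m))) p m
  = qpoch (p * p ^+ (l * m)) p m.-1 * (1 - q ^+ (d * (l.+1 * m))).
  rewrite -[m in qpoch _ _ m](prednK m0) qpochS c_one // rmorph1 mul1r.
  have -> : q^-1 * p ^+ (2 * (l * m)) * p / (q^-1 * p ^+ (l * m)) = p * p ^+ (l * m).
    rewrite mul2n -addnn exprD; move: (expf_neq0 (l * m) p0) q0.
    move: (p ^+ _) => y y0 qq; apply: (mulIf (mulf_neq0 (invr_neq0 qq) y0)).
    by rewrite divfK ?mulf_neq0 ?invr_neq0 //; ring.
  congr (_ * (1 - _)); rewrite -exprS -exprD -exprM.
  by congr (_ ^+ (_ * _)); rewrite mulSn addSnnS prednK // addnC.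
rewrite invfM mulrACA [X in X * _]mulrC -mulrACA.
have d0 : (0 < d)%N by move: dM0; rewrite muln_gt0 => /andP[].
apply: dvd_atMl; last first.
  apply: quotient_at0; rewrite ?muln_gt0 ?d0 ?m0 //; last by rewrite mulnA dvdn_mull.
  apply: dvdn_add; last by rewrite mulnA dvdn_mull.
  by move: dM; rewrite -[1]/(1%:Z) subzn // dvdzE.
apply: dvd_atMl; last first.
  have HB : dvd_at P 0 (C r * q^-1 * p ^+ (l * m)) by apply/unit_at_dvd/HC.
  apply: dvd_atMl; apply: dvd_at_qpoch => //.
  by apply: dvd_atMl => //; exact/unit_at_dvd/unit_at_p.
apply/unit_at_dvd/unit_atV/unit_at_qpoch => i im.
have -> : p * p ^+ (l * m) * p ^+ i = q ^ ((d * (l * m))%:Z + (d * i.+1)%:Z).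
  by rewrite -exprS -exprD -exprM -PoszD -mulnDr addSnnS.
apply: unit_at_1subqz => //; apply: ndvd_d; last by rewrite dvdzE /= mulnA dvdn_mull.
by rewrite /= -ltn_predRL.
Qed.

Lemma wpratio_at0 l : dvd_at P 0 (wpratio p q^-1 X (l * m)).
Proof.
elim: l => [|l IH].
  rewrite mul0n /wpratio expr0 mulr1; apply: dvd_at_prod => r _.
  by rewrite !qpoch0 divr1; apply: dvd_at1.
rewrite mulSn addnC wpratioD //; last by move=> r; rewrite mulf_neq0 ?C_neq0 ?invr_neq0.
by apply: dvd_atMl => //; exact: wpratio_block_at0.
Qed.

(** Block number [l] is the integral factor [wpratio] at [l * m] times the first block with
    exponents shifted by multiples of [m]; modulo [Phi_m] the latter agrees with the unshifted first
    block, which vanishes. *)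
Lemma wpsum_at1 l : dvd_at P 1 (\sum_(0 <= k < l * m) wpterm p q^-1 X k).
Proof.
elim: l => [|l IH]; first by rewrite mul0n big_geq //; apply: dvd_at0.
rewrite mulSn addnC (@big_cat_nat _ _ _ (l * m)) ?leq_addr //=.
apply: dvd_atD => //; rewrite -{1}[(l * m)%N]add0n big_addn addKn.
under eq_bigr do rewrite addnC wpterm_shift.
rewrite -mulr_sumr; apply: dvd_atMr; first exact: wpratio_at0.
(* A family depending on [i] alone: [true] gives the shifted exponents, [false] the original
   ones. *)
pose al (i j : bool) : int := if i then -1 + (d * (2 * (l * m)))%:Z else -1.
pose be (r : 'I_6) (i j : bool) : int := if i then -1 + (d * (l * m))%:Z else -1.
have dvd_l z : (m%:Z %| (d * (z * m))%:Z)%Z by rewrite dvdzE /= mulnA dvdn_mull.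
have qd z : (m%:Z %| z)%Z -> dvd_at P 1 (q ^ (-1 + z) - q ^ (-1)).
  by move=> mz; apply: dvd_at_diffqz => //; rewrite addrC addKr.
have quad_k k : (k < m)%N ->
    quad P (fun i j => wpterm p (q ^ al i j) (fun r => C r * q ^ be r i j) k).
  move=> km; apply: quad_wp => //.
  - apply: quad_ext (quad_left (dvd_at_qz m1 _) (dvd_at_qz m1 _) (qd _ (dvd_l (2 * l)%N))).
    by rewrite /al -mulnA => -[].
  - move=> r; apply: quad_ext (quad_left (dvd_at_qz m1 _) (dvd_at_qz m1 _) (qd _ (dvd_l l))).
    by case.
  move=> r [] j; rewrite /al /be; last by rewrite subrr dvdz0.
  have := dvd_l (2 * l)%N; rewrite -mulnA => dvd_2l.
  by rewrite opprD addrACA subrr add0r; apply: rpredB.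
rewrite -[X in dvd_at P 1 X](subrK (\sum_(0 <= k < m) wpterm p q^-1 (fun r => C r * q^-1) k)).
apply: dvd_atD; last exact: wpsum_block_at1.
rewrite -sumrB big_seq; apply: dvd_at_sum => k; rewrite mem_index_iota => /= km.
have [_ H _] := quad_k k km; exact: (H true true false false).
Qed.

Local Notation o i := (@Ordinal 6 i isT).

(** * Divisibility by Phi_m^2 when m = ds + 1 *)

Section Congruent1.
Variable s : nat.
Hypothesis s_gt0 : (0 < s)%N.
Hypothesis d_ge3 : (3 <= d)%N.
Hypothesis ms : m = (d * s).+1.
Hypothesis c01 : c (o 0) * c (o 1) = 1.
Hypothesis c23 : c (o 2) * c (o 3) = 1.
(** Since [d s] is congruent to -1 modulo [m], the inverse of [d] is [-s]. *)
Let M := (m - s)%N.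

Let ltMm : (M < m)%N. Proof. by rewrite /M; lia. Qed.
Let dM : (m%:Z %| (d * M)%:Z - 1)%Z.
Proof.
(* Indeed [d(m - s) - 1 = d m - (d s + 1) = (d - 1) m]. *)
apply/dvdzP; exists (d%:Z - 1); have sm : (s <= m)%N by nia.
by rewrite /M mulnBr -subzn ?leq_mul2l ?sm ?orbT // ms; nia.
Qed.

Lemma q_exp_neq1 k : (0 < k)%N -> 1 - q ^+ k != 0.
Proof.
move=> k0; rewrite -(rmorphXn iota) -(rmorph1 iota) -(rmorphB iota) iota_eq0.
by rewrite -oppr_eq0 opprB -size_poly_eq0 size_XnsubC.
Qed.

(* (Ap/bc)_j (Ap/de)_(M-j) = (pq)_j (pq)_(M-j) has a factor 1 - q^m, because
   M >= 2s - 1 forces s <= j or s <= M - j; this uses d >= 3. *)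
Lemma qpoch_pq_at1 j : (j <= M)%N ->
  dvd_at P 1 (qpoch (p * q) p j * qpoch (p * q) p (M - j)).
Proof.
move=> jM; have Hq : dvd_at P 0 q := unit_at_dvd (unit_at_q m1).
have Hp : dvd_at P 0 p by apply: dvd_atX.
have Hpq : dvd_at P 0 (p * q) by apply: dvd_atMl.
have H k : (s <= k)%N -> dvd_at P 1 (qpoch (p * q) p k).
  move=> sk; have sk' : (s.-1 < k)%N by rewrite prednK.
  apply: (dvd_at_qpoch_factor sk') => //.
  (* The factor of index [s - 1] is [1 - q^(ds+1) = 1 - q^m]. *)
  have -> : p * q * p ^+ s.-1 = q ^ (m%:Z).
    by rewrite mulrAC -exprS prednK // -exprM -exprSr -ms.
  exact: dvd_at_1subqz.
case: (leqP s j) => [sj|js].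
  by apply: dvd_atMl; [exact: H | exact: dvd_at_qpoch].
apply: dvd_atMr; first exact: dvd_at_qpoch.
by apply: H; move: js; rewrite /M ms; nia.
Qed.

(** At this corner the parameter [p^-M] terminates the series and Watson's transformation applies.
    One factor [Phi_m] comes from [(1/q; p)_(M+1)], whose last factor is [1 - q^(dM-1)], the other
    from [qpoch_pq_at1] in each term; the denominators are units. *)
Lemma wpdeform_watson_at2 : dvd_at P 2 (wpdeform M true false).
Proof.
have Hq : dvd_at P 0 q := unit_at_dvd (unit_at_q m1).
have Hp : dvd_at P 0 p by apply: dvd_atX.
have HX r : unit_at P (C r * q^-1) := unit_at_Cq r (-1).
pose x (r : 'I_6) := if (r < 5)%N then C r * q^-1 else p ^- M.
have -> : wpdeform M true false = \sum_(k < M.+1) wpterm p q^-1 x k.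
  rewrite /wpdeform big_mkord; apply: eq_bigr => k _; apply: eq_wpterm => r.
  rewrite /x; case: (ltnP r 5) => [r5|r5].
    case: (ltnP r 4) => // r4; have r4' : r = 4 :> nat.
      by apply/eqP; rewrite eqn_leq -ltnS r5 r4.
    by rewrite r4'.
  have r5' : r = 5 :> nat by apply/eqP; rewrite eqn_leq r5 -ltnS ltn_ord.
  by rewrite r5' /= c_one ?r5' // rmorph1 mul1r -exprnN exprM.
have xE (r : 'I_6) : (r < 4)%N -> x r = C r * q ^ (-1).
  by move=> r4; rewrite /x ltnW.
have lowE (r : 'I_6) i : (r < 4)%N -> unit_at P (1 - q^-1 * p / x r * p ^+ i).
  by move=> r4; rewrite xE //; exact: (@unit_at_lower_generic r i (-1) (-1)).
have lowk (r : 'I_6) k : (r < 4)%N -> unit_at P (qpoch (q^-1 * p / x r) p k).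
  by move=> r4; apply: unit_at_qpoch => i _; exact: lowE.
apply: (@dvd_at_unitM P 2 _ (qpoch (q^-1 * p / x (o 2)) p M * qpoch (q^-1 * p / x (o 3)) p M)).
  by apply: unit_atM; exact: lowk.
rewrite sum_wpterm_watson //; first last.
- by move=> r r4 i; apply: unit_at_neq0 (lowE r i r4).
- move=> i; have -> : q^-1 * p ^+ i.+1 = q ^+ (d * i.+1 - 1).
    apply: (mulfI q0); rewrite mulVKf // -exprM -exprS subn1 prednK //.
    by rewrite muln_gt0 andbT; lia.
  by apply: q_exp_neq1; nia.
- by move=> i; rewrite -exprM; apply: q_exp_neq1; rewrite muln_gt0 andbT; lia.
- move=> r; rewrite /x; case: ifP => _; first exact: unit_at_neq0 (HX r).
  by rewrite invr_neq0 // expf_neq0.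
- by rewrite /x /= c_one // rmorph1 mul1r.
apply: (@dvd_atM _ 1 1).
  apply: (@dvd_at_qpoch_factor _ _ _ _ _ M) => //; first exact: (dvd_at_qz m1 (-1)).
  by rewrite qM1; exact: dvd_at_1subqz.
apply: dvd_at_sum => -[j /= jM] _.
(* As [c_0 c_1 = 1], [x_0 x_1 = q^-2] and [Ap/(bc) = pq]; likewise [Ap/(de) = pq]. *)
have e01 : q^-1 * p / (x (o 0) * x (o 1)) = p * q.
  rewrite /x /= mulrACA -rmorphM -polyCM c01 rmorph1 mul1r.
  by rewrite -invfM invrK mulrACA mulVf // mul1r.
have e23 : q^-1 * p / (x (o 2) * x (o 3)) = p * q.
  rewrite /x /= mulrACA -rmorphM -polyCM c23 rmorph1 mul1r.
  by rewrite -invfM invrK mulrACA mulVf // mul1r.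
rewrite e01 e23.
have Hx (r : 'I_6) : (r < 4)%N -> dvd_at P 0 (x r).
  by move=> r4; rewrite xE //; exact/unit_at_dvd/unit_at_Cq.
have HpV k : dvd_at P 0 (p ^+ k)^-1 by apply/unit_at_dvd/unit_atV/unit_at_p.
apply: dvd_atMl; last first.
  apply: dvd_atMl; last exact: HpV.
  apply/dvd_atX/dvd_atN/dvd_atMl; last first.
    by apply/unit_at_dvd/unit_atV/unit_atM; rewrite xE //; exact: unit_at_Cq.
  by apply: dvd_atMl; [exact: (dvd_at_qz m1 (-1)) | exact: dvd_atX].
apply: dvd_atMl; last first.
  apply/unit_at_dvd/unit_atV; do ![apply: unit_atM; last exact: lowk].
  (* The factors of [(p; p)_j] are [1 - q^(d(i+1))] with [0 < i + 1 <= M < m]. *)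
  apply: unit_at_qpoch => i ij; rewrite -exprS -exprM.
  apply: (@unit_at_1subqz _ m1 (d * i.+1)%N); rewrite -[Posz _]add0r.
  apply: ndvd_d; last exact: dvdz0.
  by rewrite /=; apply: leq_ltn_trans ltMm; apply: leq_trans ij _.
apply: dvd_atMl; first exact: qpoch_pq_at1.
by apply: dvd_atMl; [apply: dvd_atMl|]; apply: dvd_at_qpoch => //; exact: Hx.
Qed.

Lemma wpsum_at2 : dvd_at P 2 (\sum_(0 <= k < m) wpterm p q^-1 X k).
Proof.
set S := \sum_(0 <= k < m) _; pose S' := \sum_(0 <= k < M.+1) wpterm p q^-1 X k.
(* The three parts are the tail beyond [M], a mixed difference, and the sum treated by Watson's
   transformation. *)
have -> : S = (S - S') + ((S' - wpdeform M true false) + wpdeform M true false).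
  by rewrite !subrK.
apply: dvd_atD; first exact: wpsum_split2.
by apply: dvd_atD wpdeform_watson_at2; exact: wpsum_head2.
Qed.
End Congruent1.
End AtPhi.
End Cyclotomic.

(** * Specialization to the constants a, 1/a, b, 1/b, 1, 1 *)

Section TwoIndeterminates.
Hypothesis char0 : forall n, (0 < n)%N -> n%:R != 0 :> K.
Local Notation Phi := (cyclop K).
Local Notation q := (iota ('X : {poly K})).
Variables a b : K.
Hypothesis a_neq0 : a != 0.
Hypothesis b_neq0 : b != 0.
Hypothesis a_generic : forall m, (0 < m)%N -> a ^+ m != 1.
Hypothesis b_generic : forall m, (0 < m)%N -> b ^+ m != 1.
Variables n d : nat.
Hypothesis n_gt1 : (1 < n)%N.
Hypothesis co_nd : coprime n d.
Local Notation S := (qsum (iota a%:P) (iota b%:P) q d n).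

(** The default value 1 of [nth] supplies the constants for [r = 4] and [r = 5]. *)
Let c (r : 'I_6) : K := nth 1 [:: a; a^-1; b; b^-1] r.

Let c_neq0 r : c r != 0.
Proof. by case: r => [[|[|[|[|[|[|i]]]]]] //= Hr]; rewrite /c /= ?invr_eq0 ?oner_neq0. Qed.

Let c_generic (r : 'I_6) m : (0 < m)%N -> (r < 4)%N -> c r ^+ m != 1.
Proof.
move=> m0; case: r => [[|[|[|[|[|[|i]]]]]] //= Hr] _; rewrite /c /= ?exprVn ?invr_eq1;
  by [exact: a_generic | exact: b_generic].
Qed.

Let c_one (r : 'I_6) : (4 <= r)%N -> c r = 1.
Proof. by case: r => [[|[|[|[|[|[|i]]]]]] //= Hr]. Qed.

Lemma qsumE : S = (\sum_(0 <= k < n)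
  wpterm (q ^+ d) q^-1 (fun r => iota (c r)%:P * q^-1) k) / (1 - q).
Proof.
have iotaV t : t != 0 -> iota t^-1%:P = (iota t%:P)^-1.
  move=> t0; apply: (mulIf (x := iota t%:P)); rewrite ?iota_eq0 ?polyC_eq0 //.
  by rewrite mulVf ?iota_eq0 ?polyC_eq0 // -rmorphM -polyCM mulVf // rmorph1.
rewrite /qsum mulr_suml; apply: eq_bigr => k _; apply: qsum_summand => //.
- exact: q_neq0.
- by rewrite iota_eq0 polyC_eq0.
- by rewrite iota_eq0 polyC_eq0.
- by rewrite /c /= iotaV // mulrC.
- by rewrite /c /= iotaV // mulrC.
- by rewrite /c /= rmorph1 mul1r.
- by rewrite /c /= rmorph1 mul1r.
Qed.

(** The remaining factor [1 / (1 - q)] is a unit at [Phi_m] because [m > 1]. *)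
Lemma qsum_at e m : (1 < m)%N ->
  dvd_at (Phi m) e (\sum_(0 <= k < n)
    wpterm (q ^+ d) q^-1 (fun r => iota (c r)%:P * q^-1) k) ->
  dvd_at (Phi m) e S.
Proof.
move=> m1 H; rewrite qsumE; apply: dvd_atMl => //; apply/unit_at_dvd/unit_atV.
by apply: (unit_at_1subqz char0 m1 (z := 1)); rewrite dvdzE /= dvdn1 gtn_eqF.
Qed.

Lemma qsum_at1 m : (1 < m)%N -> (m %| n)%N -> dvd_at (Phi m) 1 S.
Proof.
move=> m1 mn; apply: qsum_at => //; rewrite -(divnK mn).
by apply: wpsum_at1 => //; apply: coprime_dvdl co_nd.
Qed.

Lemma qsum_at2 : (3 <= d)%N -> n = 1 %[mod d] -> dvd_at (Phi n) 2 S.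
Proof.
move=> d3 nd; apply: qsum_at => //; have ns : n = (d * (n %/ d)).+1.
  by rewrite {1}(divn_eq n d) nd modn_small ?addn1 1?mulnC //; lia.
apply: (wpsum_at2 char0 c_neq0 c_generic c_one n_gt1 co_nd (s := n %/ d)) => //.
- by rewrite lt0n; apply: contraTneq n_gt1 => s0; rewrite ns s0 muln0.
- by rewrite /c /= divff.
- by rewrite /c /= divff.
Qed.
End TwoIndeterminates.

End Localization.

(** * Assembling the congruences *)

(** The factor [Phi_1 = X - 1] of [X^n - 1] cancels against [1 - X], the two signs compensating. *)
Lemma qintp_cyclop (K : fieldType) n : (0 < n)%N ->
  qintp K n = \prod_(m <- divisors n | m != 1) cyclop K m.
Proof.
move=> n0; have Phi1 : cyclop K 1 = 'X - 1.
  by have := @prod_cyclop K 1 isT; rewrite big_seq1 expr1.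
have X1 : 1 - 'X != 0 :> {poly K}.
  by rewrite -oppr_eq0 opprB -[1]/(1%:P) polyXsubC_eq0.
rewrite /qintp; have -> : 1 - 'X^n = (1 - 'X) * \prod_(m <- divisors n | m != 1) cyclop K m.
  rewrite -opprB -(prod_cyclop (K := K) n0) (bigD1_seq 1) ?divisors_uniq //=; last first.
    by rewrite -dvdn_divisors.
  by rewrite Phi1 -mulNr opprB.
by rewrite mulKp.
Qed.

Lemma coprimep_prod_dvdp (K : fieldType) (I : eqType) (r : seq I) (f : I -> {poly K}) N :
  uniq r -> (forall i j, i \in r -> j \in r -> i != j -> coprimep (f i) (f j)) ->
  (forall i, i \in r -> f i %| N) -> \prod_(i <- r) f i %| N.
Proof.
elim: r => [|i r IH] /=; first by rewrite big_nil dvd1p.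
move=> /andP[ir ur] co_f dvd_f; rewrite big_cons Gauss_dvdp.
  rewrite dvd_f ?mem_head // IH // => [j k jr kr|j jr].
    by apply: co_f; rewrite inE ?jr ?kr orbT.
  by apply: dvd_f; rewrite inE jr orbT.
rewrite big_seq; apply: (big_ind (fun g : {poly K} => is_true (coprimep (f i) g))).
- exact: coprimep1.
- by move=> g h cg ch; rewrite coprimepMr cg.
move=> j jr; apply: co_f; rewrite ?mem_head ?inE ?jr ?orbT //.
by apply: contraNneq ir => ->.
Qed.

(** One reduced fraction, obtained at [m = n], serves for every [m]: by [dvd_at_reduced] each power
    of [Phi_m] divides its numerator, and [Phi_m] is coprime to its denominator. Being pairwise
    coprime, the powers combine to their product. *)
Lemma ratcong_cyclop (K : fieldType) (x : {fraction {poly K}}) n (e : nat -> nat) :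
  (forall n, (0 < n)%N -> n%:R != 0 :> K) -> (1 < n)%N ->
  (forall m, (1 < m)%N -> (m %| n)%N ->
     dvd_at (@tofrac {poly K}) (cyclop K m) (e m) x) ->
  ratcong (\prod_(m <- divisors n | m != 1) cyclop K m ^+ e m) x 0.
Proof.
move=> char0 n1 Hx; have n0 : (0 < n)%N := ltnW n1.
have iota_inj : injective (@tofrac {poly K}) by move=> y z /eqP; rewrite tofrac_eq => /eqP.
have [N [D [D0 cND xE]]] := dvd_at_fraction iota_inj (Hx n n1 (dvdnn n)).
have HND m : m \in divisors n -> m != 1 -> cyclop K m ^+ e m %| N /\ coprimep D (cyclop K m).
  rewrite -dvdn_divisors // => mn m1; apply: (dvd_at_reduced iota_inj D0 cND).
  rewrite -xE; apply: Hx => //.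
  by rewrite ltn_neqAle eq_sym m1 (dvdn_gt0 n0 mn).
exists N, D; split=> //; first by rewrite subr0.
- rewrite -big_filter; apply: coprimep_prod_dvdp; first by rewrite filter_uniq ?divisors_uniq.
    move=> l m; rewrite !mem_filter -!dvdn_divisors // => /andP[_ ln] /andP[_ mn] lm.
    by apply/coprimep_expl/coprimep_expr; apply: coprimep_cyclop n0 ln mn lm.
  by move=> m; rewrite mem_filter => /andP[m1 mn]; have [] := HND m mn m1.
rewrite big_seq_cond.
apply: (big_ind (fun g : {poly K} => is_true (coprimep D g))).
- exact: coprimep1.
- by move=> g h cg ch; rewrite coprimepMr cg.
by move=> m /andP[mn m1]; apply: coprimep_expr; have [] := HND m mn m1.
Qed.

Lemma ratcong_qsum (K : fieldType) (a b : K) n d :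
  (forall n, (0 < n)%N -> n%:R != 0 :> K) -> a != 0 -> b != 0 ->
  (forall m, (0 < m)%N -> a ^+ m != 1) -> (forall m, (0 < m)%N -> b ^+ m != 1) ->
  (1 < n)%N -> (3 <= d)%N -> coprime n d ->
  ratcong (if n == 1 %[mod d] then qintp K n * cyclop K n else qintp K n)
    (qsum (tofrac a%:P) (tofrac b%:P) (tofrac ('X : {poly K})) d n) 0.
Proof.
move=> char0 a0 b0 ag bg n1 d3 co; have n0 : (0 < n)%N := ltnW n1.
have iota_inj : injective (@tofrac {poly K}) by move=> y z /eqP; rewrite tofrac_eq => /eqP.
(* The exponent 2 at [m = n] accounts for the extra factor [Phi_n] in [[n] Phi_n]. *)
pose e (m : nat) := if (n == 1 %[mod d]) && (m == n) then 2%N else 1%N.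
have -> : (if n == 1 %[mod d] then qintp K n * cyclop K n else qintp K n)
   = \prod_(m <- divisors n | m != 1) cyclop K m ^+ e m.
  rewrite qintp_cyclop // /e; case: ifP => _ /=; last by apply: eq_bigr => m _; rewrite expr1.
  have nn : n \in divisors n by rewrite -dvdn_divisors.
  have n1' : n != 1 by rewrite neq_ltn n1 orbT.
  rewrite -[X in X * _]big_filter -[RHS]big_filter; set r := [seq i <- _ | _].
  have nr : n \in r by rewrite mem_filter n1'.
  have ur : uniq r by rewrite filter_uniq ?divisors_uniq.
  rewrite !(bigD1_seq n nr ur) /= eqxx mulrAC -expr2; congr (_ * _).
  by apply: eq_bigr => m /negPf ->; rewrite expr1.
apply: ratcong_cyclop => // m m1 mn; rewrite /e; case: ifP => [/andP[/eqP nd /eqP ->]|_].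
  exact: (qsum_at2 iota_inj).
exact: (qsum_at1 iota_inj).
Qed.

(** * The indeterminates a and b in Q(a, b) *)

Lemma tofrac_exp_neq1 (R : idomainType) (x : R) m :
  x ^+ m != 1 -> (tofrac x) ^+ m != 1.
Proof. by rewrite -tofracXn -tofrac1 tofrac_eq. Qed.

Lemma polyX_exp_neq1 (R : nzRingType) m : (0 < m)%N -> 'X^m != 1 :> {poly R}.
Proof.
move=> m0; apply: contraTneq m0 => X1.
by have := congr1 (size \o polyseq) X1; rewrite /= size_polyXn size_poly1 => -[->].
Qed.

Lemma Qab_char0 n : (0 < n)%N -> n%:R != 0 :> Qab.
Proof.
move=> n0; rewrite -(rmorph_nat (@tofrac {poly {poly rat}})) tofrac_eq0.
rewrite -(rmorph_nat (@polyC {poly rat})) polyC_eq0 -(rmorph_nat (@polyC rat)) polyC_eq0.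
by rewrite Num.Theory.pnatr_eq0 -lt0n.
Qed.

Theorem theorem1p2 (n d : nat) (n_gt1 : (1 < n)%N) (d_ge3 : (3 <= d)%N)
    (co_nd : coprime n d) :
  let q : Qabq := var_q in
  let a : Qabq := var_a in
  let b : Qabq := var_b in
  ratcong
    (if n == 1 %[mod d] then qintp Qab n * cyclop Qab n else qintp Qab n)
    (\sum_(0 <= k < n)
       qint q ((2 * d * k)%:Z - 1)
       * (qpochs [:: a * q^-1; q^-1 / a; b * q^-1; q^-1 / b] (q ^+ d) k
          * qpoch q^-1 (q ^+ d) k ^+ 2)
       / (qpochs [:: a * q ^+ d; q ^+ d / a; b * q ^+ d; q ^+ d / b] (q ^+ d) k
          * qpoch (q ^+ d) (q ^+ d) k ^+ 2)
       * q ^+ ((2 * d + 3) * k))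
    0.
Proof.
(* The stated sum is [qsum] by conversion. It remains that Q(a, b) has characteristic zero and that
   [a] and [b] are nonzero and not roots of unity. *)
move=> q a b; apply: (@ratcong_qsum Qab indet_a indet_b n d) => //.
- exact: Qab_char0.
- by rewrite tofrac_eq0 polyC_eq0 polyX_eq0.
- by rewrite tofrac_eq0 polyX_eq0.
- move=> m m0; apply: tofrac_exp_neq1; rewrite -polyC_exp -polyC1 (inj_eq (@polyC_inj _)).
  exact: polyX_exp_neq1.
- by move=> m m0; apply/tofrac_exp_neq1/polyX_exp_neq1.
Qed.
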